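(* There exists no $(104,22)$-arc in $\operatorname{PG}(3,5)$.
   Context: A multiset of points in $\operatorname{PG}(v-1,q)$ is a map $\mathcal{K}$ from the set $\mathcal{P}$ of points to $\mathbb{N}_0$, extended additively to sets of points (so $\mathcal{K}(H)=\sum_{P\in H}\mathcal{K}(P)$). An $(n,s)$-arc is a multiset $\mathcal{K}$ with $\mathcal{K}(\mathcal{P})=n$ such that $\mathcal{K}(H)\le s$ for every hyperplane $H$, with equality for at least one hyperplane. *)

(* Defs.v *)
From HB Require Import structures.
From mathcomp Require Import all_boot all_order all_algebra.

Set Implicit Arguments.
Unset Strict Implicit.
Unset Printing Implicit Defensive.

Section FiniteVspace.

(* Only this module lets the inference see {vspace vT} as a subtype of the
   finite type of matrices over F. *)
Import VectorInternalTheory.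

Variables (F : finFieldType) (vT : vectType F).

HB.instance Definition _ := [Countable of {vspace vT} by <:].
HB.instance Definition _ := [Finite of {vspace vT} by <:].

End FiniteVspace.

(* PG(d, F) is the lattice of subspaces of F^(d+1); d is the projective
   dimension, so a hyperplane is a subspace of vector-space dimension d. *)
Notation pg_space F d := {vspace 'rV[F]_d.+1}.

Definition is_point (F : finFieldType) (d : nat) (P : pg_space F d) : bool :=
  \dim P == 1%N.

Definition is_hyperplane (F : finFieldType) (d : nat) (H : pg_space F d) : bool :=
  \dim H == d.

Notation pg_point F d := {P : pg_space F d | is_point P}.

Definition pg_multiset (F : finFieldType) (d : nat) : Type := pg_point F d -> nat.

Definition mult (F : finFieldType) (d : nat) (K : pg_multiset F d)
    (S : {set pg_point F d}) : nat :=
  \sum_(P in S) K P.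

Definition points_in (F : finFieldType) (d : nat) (U : pg_space F d) :
    {set pg_point F d} :=
  [set P | (val P <= U)%VS].

Definition is_arc (F : finFieldType) (d : nat) (n s : nat)
    (K : pg_multiset F d) : Prop :=
  [/\ mult K [set: pg_point F d] = n,
      forall H : pg_space F d, is_hyperplane H -> mult K (points_in H) <= s
    & exists2 H : pg_space F d, is_hyperplane H & mult K (points_in H) = s].

(* Main.v *)
(* Counting on pencils of planes shows that an arc K is a set of points meeting
   every line in at most 5 points.  Give a plane h the weight 22 - |K meet h|.  A
   second moment argument inside h shows that a nonzero weight is 1, 2 or 3 modulo
   5, once the polynomial method has excluded planes disjoint from K.  Write the weight
   as t + 5 u with t <= 3.  Since |K| - |K meet h| is modulo 5 the sum over p in K
   of (p . h)^4, the residue t(h) is up to a constant a quartic form in h, and this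
   form misses one value of F_5.

   By the second moment of the weights, the planes through some point of K have
   total residue at most 23.  Putting such a point and a second point of K on
   coordinate axes makes enough slices of the quartic so light that all
   candidates can be enumerated.  The moments of t and u rule out all
   of them but one projective class; there some plane has u >= 2, and no
   choice of the points of K in that plane respects the bounds on its lines. *)

From HB Require Import structures.
Require Import Defs.
From mathcomp Require Import all_boot all_order all_algebra.
From mathcomp Require Import zify_ssreflect.
From Stdlib Require Import Ring ZArith Lia.

Set Implicit Arguments.
Unset Strict Implicit.
Unset Printing Implicit Defensive.

(** * The field with five elements and its projective space *)

(** A quartic form in four variables has 35 coefficients, too many to enumerate blindly, so the form
    is assembled from slices. The six planes through a line with five points of K have total weight
    6 * 22 - 104 - 25 = 3; up to GL_2(5) this leaves three binary quartics on that pencil. The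
    planes through a point of K have total weight 58 - 25 = 33, so at a point of K on that line the
    25 planes off the pencil have total residue at most 30, and at most 20 for the light point. On
    these 25 planes the form has 10 unknown coefficients, and the budget 30 prunes them row by row.
    Two points of K on the line yield 5 + 10 + 10 coefficients. The 10 mixed ones are recovered, up
    to one free parameter, from the slices at two further points of the line, which has three more
    points of K.

    Planes disjoint from K need an argument of their own: their weight 22 has the permitted residue
    2, yet the existence of a light point relies on every plane meeting K. *)

(* Unlike 'F_5, this representation computes fast inside the kernel. *)
Inductive F5 := Z0 | Z1 | Z2 | Z3 | Z4.

Definition F5_eqb (a b : F5) : bool :=
  match a, b with
  | Z0, Z0 | Z1, Z1 | Z2, Z2 | Z3, Z3 | Z4, Z4 => true
  | _, _ => false
  end.

Lemma F5_eqP : Equality.axiom F5_eqb.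
Proof. by case; case; constructor. Qed.

HB.instance Definition _ := hasDecEq.Build F5 F5_eqP.

Definition add (a b : F5) : F5 :=
  match a, b with
  | Z0, x | x, Z0 => x
  | Z1, Z1 | Z3, Z4 | Z4, Z3 => Z2
  | Z1, Z2 | Z2, Z1 | Z4, Z4 => Z3
  | Z1, Z3 | Z3, Z1 | Z2, Z2 => Z4
  | Z1, Z4 | Z4, Z1 | Z2, Z3 | Z3, Z2 => Z0
  | Z2, Z4 | Z4, Z2 | Z3, Z3 => Z1
  end.

Definition opp (a : F5) : F5 :=
  match a with Z0 => Z0 | Z1 => Z4 | Z2 => Z3 | Z3 => Z2 | Z4 => Z1 end.

Definition mul (a b : F5) : F5 :=
  match a, b with
  | Z0, _ | _, Z0 => Z0
  | Z1, x | x, Z1 => x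
  | Z2, Z2 | Z3, Z3 => Z4
  | Z2, Z3 | Z3, Z2 | Z4, Z4 => Z1
  | Z2, Z4 | Z4, Z2 => Z3
  | Z3, Z4 | Z4, Z3 => Z2
  end.

Definition inv (a : F5) : F5 :=
  match a with Z0 => Z0 | Z1 => Z1 | Z2 => Z3 | Z3 => Z2 | Z4 => Z4 end.

Definition sub a b := add a (opp b).

Arguments add : simpl never.
Arguments mul : simpl never.
Arguments opp : simpl never.
Arguments sub : simpl never.

Lemma F5_ring : ring_theory Z0 Z1 add mul sub opp (@eq F5).
Proof. by split; repeat case. Qed.

Lemma F5_eqb_eq a b : F5_eqb a b = true -> a = b.
Proof. by move/F5_eqP. Qed.

Ltac F5_cst t :=
  match t with
  | Z0 => t | Z1 => t | Z2 => t | Z3 => t | Z4 => t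
  | _ => constr:(NotConstant)
  end.
Add Ring F5_ring_inst : F5_ring (decidable F5_eqb_eq, constants [F5_cst]).

Declare Scope F5_scope.
Delimit Scope F5_scope with F5.
Infix "+" := add : F5_scope.
Infix "*" := mul : F5_scope.
Infix "-" := sub : F5_scope.
Notation "- x" := (opp x) : F5_scope.

Definition F5s : seq F5 := [:: Z0; Z1; Z2; Z3; Z4].

Lemma mem_F5s a : a \in F5s.
Proof. by case: a. Qed.

Lemma F5_forall (P : F5 -> bool) : all P F5s -> forall a, P a.
Proof. by move=> /allP h a; apply: h; apply: mem_F5s. Qed.

Definition is0 (a : F5) : bool := if a is Z0 then true else false.

Lemma is0P a : reflect (a = Z0) (is0 a).
Proof. by case: a; constructor. Qed.

Definition V : Type := (F5 * F5 * F5 * F5)%type.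

Definition dot (u v : V) : F5 :=
  let: (a, b, c, d) := u in let: (x, y, z, t) := v in
  (a * x + b * y + c * z + d * t)%F5.

Definition vadd (u v : V) : V :=
  let: (a, b, c, d) := u in let: (x, y, z, t) := v in
  (a + x, b + y, c + z, d + t)%F5.

Definition vscale (s : F5) (v : V) : V :=
  let: (x, y, z, t) := v in (s * x, s * y, s * z, s * t)%F5.

Definition v0 : V := (Z0, Z0, Z0, Z0).

Definition orth (h p : V) : bool := is0 (dot h p).

(* Each point of PG(3,5) is represented by its vector with last nonzero
   coordinate 1; by the same convention a vector stands for a plane. *)
Definition pts : seq V :=
  flatten [seq flatten [seq [seq (x, y, z, Z1) | x <- F5s] | y <- F5s] | z <- F5s]
  ++ flatten [seq [seq (x, y, Z1, Z0) | x <- F5s] | y <- F5s]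
  ++ [seq (x, Z1, Z0, Z0) | x <- F5s] ++ [:: (Z1, Z0, Z0, Z0)].

Lemma size_pts : size pts = 156.
Proof. by vm_compute. Qed.

Opaque pts.

Definition vnorm (v : V) : V :=
  let: (x, y, z, t) := v in
  vscale (inv (if ~~ is0 t then t else if ~~ is0 z then z
               else if ~~ is0 y then y else x)) v.

Lemma dotC u v : dot u v = dot v u.
Proof. by case: u => [[[a b] c] d]; case: v => [[[x y] z] t] /=; ring. Qed.

Lemma orthC u v : orth u v = orth v u.
Proof. by rewrite /orth dotC. Qed.

Lemma dotDl u v w : dot (vadd u v) w = (dot u w + dot v w)%F5.
Proof.
by case: u => [[[a b] c] d]; case: v => [[[x y] z] t];
   case: w => [[[p q] r] s] /=; ring.
Qed.

Lemma dotZl s u v : dot (vscale s u) v = (s * dot u v)%F5.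
Proof. by case: u => [[[a b] c] d]; case: v => [[[x y] z] t] /=; ring. Qed.

Lemma V_forall (P : V -> bool) :
  all (fun x => all (fun y => all (fun z => all (fun t => P (x, y, z, t))
    F5s) F5s) F5s) F5s -> forall v, P v.
Proof.
move=> h [[[x y] z] t].
by move/F5_forall/(_ x)/F5_forall/(_ y)/F5_forall/(_ z)/F5_forall/(_ t): h.
Qed.

Lemma vnorm_pts (v : V) : v != v0 -> vnorm v \in pts.
Proof.
apply/implyP; move: v; apply: V_forall; by vm_compute.
Qed.

Lemma pts_norm (p : V) : p \in pts -> vnorm p = p.
Proof.
move=> hp; apply/eqP; move: p hp.
by apply/allP; vm_compute.
Qed.

Lemma pts_neq0 (p : V) : p \in pts -> p != v0.
Proof. by move: p; apply/allP; vm_compute. Qed.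

Lemma uniq_pts : uniq pts.
Proof. by vm_compute. Qed.

Lemma vnormE (v : V) : v != v0 -> exists2 c, c != Z0 & vnorm v = vscale c v.
Proof.
case: v => [[[x y] z] t] hv; rewrite /vnorm.
eexists; last by [].
by move: hv; case: x; case: y; case: z; case: t.
Qed.

Lemma vnormZ (c : F5) (v : V) : c != Z0 -> vnorm (vscale c v) = vnorm v.
Proof.
move=> hc; apply/eqP; move: v; apply: V_forall; move: hc.
by case: c => // _; vm_compute.
Qed.

Lemma orthZl (c : F5) (u v : V) : c != Z0 -> orth (vscale c u) v = orth u v.
Proof. by rewrite /orth dotZl; case: c => // _; case: (dot u v). Qed.

Lemma sum_bool (T : Type) (r : seq T) (b : pred T) :
  \sum_(x <- r) (b x : nat) = \sum_(x <- r | b x) 1.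
Proof. by rewrite [RHS]big_mkcond; apply: eq_bigr => x _; case: (b x). Qed.

Lemma sum_if (T : Type) (r : seq T) (P Q : pred T) c :
  \sum_(x <- r | P x) (if Q x then c else 0) = c * \sum_(x <- r | P x && Q x) 1.
Proof.
by rewrite -big_mkcondr big_distrr /=; apply: eq_bigr => x _; rewrite muln1.
Qed.

Lemma leq_sum_mem (T : eqType) (r : seq T) (P : pred T) (F : T -> nat) (x : T) :
  x \in r -> P x -> F x <= \sum_(y <- r | P y) F y.
Proof. by move=> hx Px; rewrite (big_rem x hx) Px leq_addr. Qed.

Lemma count_orth (g : V) : g != v0 -> \sum_(h <- pts | orth g h) 1 = 31.
Proof.
move=> hg; rewrite sum1_count; apply/eqP; move: hg; apply/implyP; move: g.
by apply: V_forall; vm_compute.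
Qed.

Definition pencil (h h' : V) : seq V :=
  h' :: [seq vadd h (vscale s h') | s <- F5s].

Definition indep (h h' : V) : bool := all (fun g => g != v0) (pencil h h').

Lemma pencil_orth h h' p :
  \sum_(g <- pencil h h') (orth g p : nat) = 1 + 5 * (orth h p && orth h' p).
Proof.
rewrite /pencil /= !big_cons big_nil /orth !dotDl !dotZl.
by case: (dot h p); case: (dot h' p).
Qed.

(* A plane of the pencil on the line h = h' = 0 covers each point of the line
   six times and every other point once. *)
Lemma pencil_sum h h' (phi : V -> nat) :
  \sum_(g <- pencil h h') \sum_(p <- pts | orth g p) phi p =
  \sum_(p <- pts) phi p + 5 * \sum_(p <- pts | orth h p && orth h' p) phi p.
Proof.
under eq_bigr do rewrite big_mkcond.
rewrite exchange_big /= big_distrr /= [in X in _ = _ + X]big_mkcond -big_split /=.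
apply: eq_bigr => p _.
have -> : \sum_(g <- pencil h h') (if orth g p then phi p else 0)
  = (\sum_(g <- pencil h h') (orth g p : nat)) * phi p.
  by rewrite big_distrl; apply: eq_bigr => g _; case: orth; rewrite /= ?mul1n ?mul0n.
by rewrite pencil_orth; case: (_ && _); lia.
Qed.

Lemma count_orth2 h h' : indep h h' ->
  \sum_(p <- pts | orth h p && orth h' p) 1 = 6.
Proof.
move=> /allP hi; have := pencil_sum h h' (fun=> 1).
rewrite big_seq (eq_bigr (fun=> 31)) => [|g /hi /count_orth //].
by rewrite -big_seq big_const_seq count_predT iter_addn sum1_size size_pts /=; lia.
Qed.

Lemma pts_indep (p q : V) : p \in pts -> q \in pts -> p != q -> indep p q.
Proof.
move=> hp hq; apply/implyP; move: q hq; apply/allP; move: p hp; apply/allP.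
by vm_compute.
Qed.

(** * Arcs and changes of coordinates *)

Definition plsum (k : V -> nat) (h : V) : nat := \sum_(p <- pts | orth h p) k p.

(** Multiplicities live on all vectors and are invariant under scaling, so a change of coordinates
    is plain composition with a matrix, without normalising representatives. *)
Record arc (k : V -> nat) : Prop := Arc {
  arc_inv : forall (c : F5) (v : V), c != Z0 -> k (vscale c v) = k v;
  arc_tot : \sum_(p <- pts) k p = 104;
  arc_pl : forall h : V, h != v0 -> plsum k h <= 22 }.

Definition mat : Type := (V * V * V * V)%type.

Definition mapply (M : mat) (v : V) : V :=
  let: (m1, m2, m3, m4) := M in let: (x, y, z, t) := v in
  vadd (vscale x m1) (vadd (vscale y m2) (vadd (vscale z m3) (vscale t m4))).

(* N acts on planes as M acts on points: the two bases are dual. *)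
Definition dualmat (M N : mat) : bool :=
  let: (m1, m2, m3, m4) := M in let: (n1, n2, n3, n4) := N in
  [&& dot n1 m1 == Z1, dot n1 m2 == Z0, dot n1 m3 == Z0, dot n1 m4 == Z0,
      dot n2 m1 == Z0, dot n2 m2 == Z1, dot n2 m3 == Z0, dot n2 m4 == Z0,
      dot n3 m1 == Z0, dot n3 m2 == Z0, dot n3 m3 == Z1, dot n3 m4 == Z0,
      dot n4 m1 == Z0, dot n4 m2 == Z0, dot n4 m3 == Z0 & dot n4 m4 == Z1].

Lemma dot_mapply M N h p : dualmat M N ->
  dot (mapply N h) (mapply M p) = dot h p.
Proof.
case: M => [[[m1 m2] m3] m4]; case: N => [[[n1 n2] n3] n4] /=.
do 15![case/andP => /eqP ?]; move=> /eqP ?.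
case: h => [[[a b] c] d]; case: p => [[[x y] z] t].
have dD u v w : dot u (vadd v w) = (dot u v + dot u w)%F5.
  by rewrite ![dot u _]dotC dotDl.
have dZ s u v : dot u (vscale s v) = (s * dot u v)%F5.
  by rewrite ![dot u _]dotC dotZl.
rewrite !dotDl !dotZl !dD !dZ.
do 16?match goal with H : dot _ _ = _ |- _ => rewrite {}H end.
by rewrite /dot; ring.
Qed.

Lemma dot_inj u v : (forall h, dot h u = dot h v) -> u = v.
Proof.
case: u => [[[a b] c] d]; case: v => [[[x y] z] t] e.
have := e (Z1, Z0, Z0, Z0); have := e (Z0, Z1, Z0, Z0).
have := e (Z0, Z0, Z1, Z0); have := e (Z0, Z0, Z0, Z1).
rewrite /dot => e4 e3 e2 e1.
by congr (_, _, _, _); [move: e1|move: e2|move: e3|move: e4] => e'; ring [e'].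
Qed.

Lemma dot0 u : dot v0 u = Z0.
Proof. by case: u => [[[a b] c] d] /=; ring. Qed.

Lemma vscale0 u : vscale Z0 u = v0.
Proof. by case: u => [[[a b] c] d]; congr (_, _, _, _); ring. Qed.

Section Frame.
Variables (M N : mat) (MN : dualmat M N).

Lemma mapplyZ c p : mapply M (vscale c p) = vscale c (mapply M p).
Proof.
case: M => [[[[[[a1 a2] a3] a4] [[[b1 b2] b3] b4]] [[[c1 c2] c3] c4]] [[[d1 d2] d3] d4]].
case: p => [[[x y] z] t] /=; rewrite /vadd /vscale.
by congr (_, _, _, _); ring.
Qed.

Lemma mapplyD p q : mapply M (vadd p q) = vadd (mapply M p) (mapply M q).
Proof.
case: M => [[[[[[a1 a2] a3] a4] [[[b1 b2] b3] b4]] [[[c1 c2] c3] c4]] [[[d1 d2] d3] d4]].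
case: p => [[[x y] z] t]; case: q => [[[x' y'] z'] t'] /=; rewrite /vadd /vscale.
by congr (_, _, _, _); ring.
Qed.

Lemma mapply_inj : injective (mapply M).
Proof.
by move=> p q e; apply: dot_inj => h; rewrite -!(dot_mapply h _ MN) e.
Qed.

Lemma mapply_neq0 (p : V) : p != v0 -> mapply M p != v0.
Proof.
apply: contraNneq => e; apply/eqP/mapply_inj; rewrite e.
by rewrite -[in RHS](vscale0 v0) mapplyZ vscale0.
Qed.

Lemma dual_neq0 (h : V) : h != v0 -> mapply N h != v0.
Proof.
apply: contraNneq => e; apply/eqP/dot_inj => p.
by rewrite ![dot p _]dotC -(dot_mapply h p MN) e !dot0.
Qed.

Lemma perm_mapply : perm_eq [seq vnorm (mapply M p) | p <- pts] pts.
Proof.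
have un : uniq [seq vnorm (mapply M p) | p <- pts].
  rewrite map_inj_in_uniq ?uniq_pts // => p q hp hq e.
  have hp0 := mapply_neq0 (pts_neq0 hp); have hq0 := mapply_neq0 (pts_neq0 hq).
  case: (vnormE hp0) => c hc ec; case: (vnormE hq0) => d hd ed.
  move: e; rewrite ec ed -!mapplyZ => /mapply_inj e.
  by rewrite -(pts_norm hp) -(pts_norm hq) -(vnormZ p hc) -(vnormZ q hd) e.
have sub : {subset [seq vnorm (mapply M p) | p <- pts] <= pts}.
  by move=> _ /mapP[p hp ->]; apply/vnorm_pts/mapply_neq0/pts_neq0.
apply: (uniq_perm un uniq_pts).
by have [_ hh] := uniq_min_size un sub (eq_leq (esym (size_map _ _))).
Qed.
End Frame.

Lemma mapply_sum M N (P : pred V) (phi : V -> nat) : dualmat M N ->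
  (forall (c : F5) (v : V), c != Z0 -> P (vscale c v) = P v) ->
  (forall (c : F5) (v : V), c != Z0 -> phi (vscale c v) = phi v) ->
  \sum_(p <- pts | P (mapply M p)) phi (mapply M p) = \sum_(p <- pts | P p) phi p.
Proof.
move=> MN hP hphi; rewrite -[RHS](perm_big _ (perm_mapply MN)) [RHS]big_map.
rewrite big_seq_cond [RHS]big_seq_cond.
apply: eq_big => [p|p /andP[hp _]].
  case hp: (p \in pts) => //=.
  by case: (vnormE (mapply_neq0 MN (pts_neq0 hp))) => c hc ->; rewrite hP.
by case: (vnormE (mapply_neq0 MN (pts_neq0 hp))) => c hc ->; rewrite hphi.
Qed.

Lemma arc_norm k (v : V) : arc k -> v != v0 -> k (vnorm v) = k v.
Proof. by move=> ak /vnormE [c hc ->]; rewrite (arc_inv ak). Qed.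

Lemma orthZr (c : F5) (u v : V) : c != Z0 -> orth u (vscale c v) = orth u v.
Proof. by move=> hc; rewrite orthC orthZl // orthC. Qed.

Lemma plsum_map M N k h : dualmat M N -> arc k ->
  plsum (k \o mapply M) h = plsum k (mapply N h).
Proof.
move=> MN ak; rewrite /plsum -(mapply_sum (P := orth (mapply N h)) MN) => [|c v|c v].
- by apply: eq_bigl => p; rewrite /orth (dot_mapply _ _ MN).
- exact: orthZr.
- exact: (arc_inv ak).
Qed.

Lemma arc_map M N k : dualmat M N -> arc k -> arc (k \o mapply M).
Proof.
move=> MN ak; split=> [c v hc||h hh] /=.
- by rewrite mapplyZ (arc_inv ak).
- rewrite -(arc_tot ak); apply: (mapply_sum (P := predT) MN) => //.
  exact: (arc_inv ak).
- by rewrite (plsum_map _ MN) // (arc_pl ak) // (dual_neq0 MN).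
Qed.

Definition e1 : V := (Z1, Z0, Z0, Z0).
Definition e2 : V := (Z0, Z1, Z0, Z0).
Definition e3 : V := (Z0, Z0, Z1, Z0).
Definition e4 : V := (Z0, Z0, Z0, Z1).

(** The last nonzero coordinate of p in [pts] is 1; putting p in place of that unit vector gives a
    basis whose dual needs no division. *)
Definition frame4 (p : V) : mat * mat :=
  let: (a, b, c, d) := p in
  if ~~ is0 d then
    ((e1, e2, e3, p), ((Z1, Z0, Z0, - a), (Z0, Z1, Z0, - b), (Z0, Z0, Z1, - c), e4))%F5
  else if ~~ is0 c then
    ((e1, e2, e4, p), ((Z1, Z0, - a, Z0), (Z0, Z1, - b, Z0), e4, e3))%F5
  else if ~~ is0 b then ((e1, e3, e4, p), ((Z1, - a, Z0, Z0), e3, e4, e2))%F5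
  else ((e2, e3, e4, e1), (e2, e3, e4, e1)).

Definition frame3 (p : V) : mat * mat :=
  let: (a, b, c, d) := p in
  if ~~ is0 c then
    ((e1, e2, p, e4), ((Z1, Z0, - a, Z0), (Z0, Z1, - b, Z0), e3, e4))%F5
  else if ~~ is0 b then ((e1, e3, p, e4), ((Z1, - a, Z0, Z0), e3, e2, e4))%F5
  else ((e2, e3, e1, e4), (e2, e3, e1, e4)).

Lemma dualmatC M N : dualmat M N = dualmat N M.
Proof.
case: M => [[[m1 m2] m3] m4]; case: N => [[[n1 n2] n3] n4] /=.
rewrite ![dot m1 _]dotC ![dot m2 _]dotC ![dot m3 _]dotC ![dot m4 _]dotC.
by apply/idP/idP; do 15![case/andP => ->]; move->.
Qed.

Lemma frame4P (p : V) : p \in pts ->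
  dualmat (frame4 p).1 (frame4 p).2 /\ mapply (frame4 p).1 e4 = p.
Proof.
move=> hp; suff /andP[? /eqP ?] : dualmat (frame4 p).1 (frame4 p).2 &&
  (mapply (frame4 p).1 e4 == p) by [].
by move: p hp; apply/allP; vm_compute.
Qed.

Definition pts3 : seq V := [seq p <- pts | orth e4 p].

Lemma frame3P (p : V) : p \in pts3 ->
  [/\ dualmat (frame3 p).1 (frame3 p).2, mapply (frame3 p).1 e4 = e4
    & mapply (frame3 p).1 e3 = p].
Proof.
move=> hp; suff /and3P[? /eqP ? /eqP ?] : [&& dualmat (frame3 p).1 (frame3 p).2,
  mapply (frame3 p).1 e4 == e4 & mapply (frame3 p).1 e3 == p] by [].
by move: p hp; apply/allP; vm_compute.
Qed.

(** * Counts on the lines and through the points of an arc *)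

Definition lnsum (k : V -> nat) (h h' : V) : nat :=
  \sum_(p <- pts | orth h p && orth h' p) k p.

Section Arc.
Variables (k : V -> nat) (ak : arc k).

Lemma pencil_plsum h h' :
  \sum_(g <- pencil h h') plsum k g = 104 + 5 * lnsum k h h'.
Proof. by rewrite pencil_sum (arc_tot ak). Qed.

(** The five planes of the pencil other than h' hold at most 110 in total, against 104 + 5 [lnsum]
    for all six. *)
Lemma lnsum_plsum h h' : indep h h' -> 5 * lnsum k h h' <= plsum k h' + 6.
Proof.
rewrite /indep /= => /andP[_ /and5P[h0 h1 h2 h3 /andP[h4 _]]].
have := pencil_plsum h h'; rewrite /= !big_cons big_nil.
have := arc_pl ak h0; have := arc_pl ak h1; have := arc_pl ak h2.
have := arc_pl ak h3; have := arc_pl ak h4; lia.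
Qed.

Lemma lnsum_le5 h h' : indep h h' -> lnsum k h h' <= 5.
Proof.
move=> hi; have := lnsum_plsum hi.
have : plsum k h' <= 22 by apply: (arc_pl ak); move: hi; rewrite /indep /= => /andP[].
lia.
Qed.

(** A point q other than p shares 6 planes with p, while p itself lies on 31 = 6 + 25. *)
Lemma point_sum (p : V) (phi : V -> nat) : p \in pts ->
  \sum_(h <- pts | orth p h) \sum_(q <- pts | orth h q) phi q =
  6 * \sum_(q <- pts) phi q + 25 * phi p.
Proof.
move=> hp.
under eq_bigr do rewrite big_mkcond.
rewrite exchange_big /= big_distrr /= (bigD1_seq p) ?uniq_pts //=.
rewrite [in RHS](bigD1_seq p) ?uniq_pts //=.
have -> : \sum_(i <- pts | orth p i) (if orth i p then phi p else 0) = 31 * phi p.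
  rewrite -(count_orth (pts_neq0 hp)) big_distrl /=; apply: eq_bigr => i.
  by rewrite orthC => ->; rewrite mul1n.
suff -> : \sum_(i <- pts | i != p) \sum_(i0 <- pts | orth p i0)
     (if orth i0 i then phi i else 0) = \sum_(i <- pts | i != p) 6 * phi i.
  by rewrite addnAC -mulnDl.
rewrite big_seq_cond [RHS]big_seq_cond; apply: eq_bigr => q /andP[hq hqp].
rewrite -(count_orth2 (pts_indep hp hq _)) 1?eq_sym // big_distrl /= [RHS]big_mkcondr.
by apply: eq_bigr => h _; rewrite orthC; case: (orth q h); rewrite ?mul1n.
Qed.

Lemma point_plsum (p : V) : p \in pts ->
  \sum_(h <- pts | orth p h) plsum k h = 624 + 25 * k p.
Proof. by move=> hp; rewrite point_sum // (arc_tot ak). Qed.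

Definition lines4 : seq V :=
  e4 :: flatten [seq [seq vnorm (vadd q (vscale s e4)) | s <- F5s] | q <- pts3].

Lemma perm_lines4 : perm_eq lines4 pts.
Proof. by vm_compute. Qed.
End Arc.

(** Here [pencil] is read among points: it lists the six points of the line joining p and q. *)
Definition spsum (k : V -> nat) (p q : V) : nat := \sum_(g <- pencil p q) k g.

Lemma spsum_lnsum k (p : V) : arc k -> p \in pts3 ->
  spsum k p e4 = lnsum (k \o mapply (frame3 p).1) e2 e1.
Proof.
move=> ak /frame3P; set M := _.1; set N := _.2 => -[MN M4 M3].
have ak' := arc_map MN ak.
have pm : perm_eq [seq q <- pts | orth e2 q && orth e1 q] (map vnorm (pencil e3 e4)).
  by vm_compute.
rewrite /spsum /lnsum -[RHS]big_filter (perm_big _ pm) [RHS]big_map.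
rewrite (_ : pencil p e4 = map (mapply M) (pencil e3 e4)); last first.
  rewrite /pencil map_cons -map_comp M4; congr (_ :: _); apply: eq_map => s.
  by rewrite /comp mapplyD mapplyZ M3 M4.
rewrite [LHS]big_map big_seq [RHS]big_seq; apply: eq_bigr => g hg.
by rewrite (arc_norm ak') //; move: g hg; apply/allP.
Qed.

Lemma spsum_le5 k (p : V) : arc k -> p \in pts3 -> spsum k p e4 <= 5.
Proof.
move=> ak hp; have [MN _ _] := frame3P hp; rewrite spsum_lnsum //.
by apply: lnsum_le5 (arc_map MN ak) _ _ _; vm_compute.
Qed.

Lemma lines4_sum k : arc k ->
  k e4 + \sum_(q <- pts3) \sum_(s <- F5s) k (vadd q (vscale s e4)) = 104.
Proof.
move=> ak; rewrite -(arc_tot ak) -[RHS](perm_big _ perm_lines4) [RHS]big_cons.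
congr (_ + _); rewrite [RHS]big_flatten [RHS]big_map big_seq [RHS]big_seq.
apply: eq_bigr => q hq; rewrite [RHS]big_map; apply: eq_bigr => s _.
rewrite (arc_norm ak) //; move: q hq; apply/allP.
by case: s; vm_compute.
Qed.

Lemma spsum_total k : arc k ->
  \sum_(q <- pts3) spsum k q e4 = 104 + 30 * k e4.
Proof.
move=> ak; have <- := lines4_sum ak.
have -> : \sum_(q <- pts3) spsum k q e4
    = 31 * k e4 + \sum_(q <- pts3) \sum_(s <- F5s) k (vadd q (vscale s e4)).
  under eq_bigr do rewrite /spsum big_cons big_map.
  by rewrite big_split big_const_seq count_predT iter_addn addn0 mulnC.
by rewrite addnAC -mulSn.
Qed.

(** The 31 lines through p carry at most 5 each and all of them count p, so 104 + 30 k(p) <= 155. *)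
Lemma arc_le1 k (p : V) : arc k -> p \in pts -> k p <= 1.
Proof.
move=> ak /frame4P; set M := _.1; set N := _.2 => -[MN M4].
have ak' := arc_map MN ak; rewrite -M4 -[k _]/((k \o mapply M) e4).
have : \sum_(q <- pts3) spsum (k \o mapply M) q e4 <= \sum_(q <- pts3) 5.
  by rewrite big_seq [X in _ <= X]big_seq leq_sum // => q hq; apply: spsum_le5.
rewrite (spsum_total ak') big_const_seq count_predT iter_addn.
by rewrite -[size pts3]/31; lia.
Qed.

(** With at most 4 on each line through [e4], the same count would read 104 + 30 <= 124. *)
Lemma tangent k : arc k -> k e4 = 1 ->
  exists2 q : V, q \in pts3 & spsum k q e4 = 5.
Proof.
move=> ak k4.
have [/hasP[q hq /eqP e]|] := boolP (has (fun q : V => spsum k q e4 == 5) pts3).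
  by exists q.
move=> /hasPn no; exfalso.
have : \sum_(q <- pts3) spsum k q e4 <= \sum_(q <- pts3) 4.
  rewrite big_seq [X in _ <= X]big_seq leq_sum // => q hq.
  by have := no q hq; have := spsum_le5 ak hq; lia.
rewrite (spsum_total ak) k4 big_const_seq count_predT iter_addn.
by rewrite -[size pts3]/31; lia.
Qed.

(** The analogue of [point_sum] in a projective plane. Since [pts3] represents both the points and
    the lines of the plane t = 0, it also applies with the two roles exchanged. *)
Lemma plane_double (p : V) (phi : V -> nat) : p \in pts3 ->
  \sum_(g <- pts3 | orth p g) \sum_(q <- pts3 | orth g q) phi q =
  \sum_(q <- pts3) phi q + 5 * phi p.
Proof.
move=> hp.
have cnt : forall q : V, q \in pts3 ->
    \sum_(g <- pts3 | orth p g && orth g q) 1 = 1 + 5 * (q == p).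
  move=> q hq; rewrite sum1_count; apply/eqP; move: q hq; apply/allP.
  by move: p hp; apply/allP; vm_compute.
under eq_bigr do rewrite big_mkcond.
rewrite exchange_big /=.
have up : uniq pts3 by rewrite filter_uniq ?uniq_pts.
transitivity (\sum_(q <- pts3) (phi q + (if q == p then 5 * phi p else 0))).
  rewrite big_seq [RHS]big_seq; apply: eq_bigr => q hq.
  by rewrite sum_if (cnt q hq); case: eqP => [->|_]; lia.
rewrite big_split -big_mkcond /=; congr (_ + _).
by rewrite -big_filter (filter_pred1_uniq up hp) big_seq1.
Qed.

(** * Weights of planes *)

Section Plane.
Variables (k : V -> nat) (m : nat).
Hypothesis k1 : forall p : V, p \in pts3 -> k p <= 1.
Hypothesis km : \sum_(p <- pts3) k p = m.
Let kappa (g : V) := \sum_(q <- pts3 | orth g q) k q.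
Hypothesis kline : forall g : V, g \in pts3 -> 5 * kappa g <= m + 6.

(* A line meets k in at most s points; v is its deficiency. *)
Let s := (m + 6) %/ 5.
Let v (g : V) := s - kappa g.
Let vs (p : V) := \sum_(g <- pts3 | orth p g) v g.

Let kv g : g \in pts3 -> kappa g + v g = s.
Proof. by move=> /kline hg; rewrite /v /s; lia. Qed.

Let cnt6 (p : V) : p \in pts3 -> \sum_(g <- pts3 | orth p g) 1 = 6.
Proof.
by move=> hp; rewrite sum1_count; apply/eqP; move: p hp; apply/allP; vm_compute.
Qed.

Let vsE p : p \in pts3 -> vs p + (m + 5 * k p) = 6 * s.
Proof.
move=> hp; rewrite -km -(plane_double k hp) -(cnt6 hp) big_distrl /= -big_split /=.
rewrite big_seq_cond [RHS]big_seq_cond; apply: eq_bigr => g /andP[hg _].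
by rewrite mul1n -(kv hg) addnC.
Qed.

Let vtot : \sum_(g <- pts3) v g + 6 * m = 31 * s.
Proof.
have -> : 6 * m = \sum_(g <- pts3) kappa g.
  rewrite /kappa; under eq_bigr do rewrite big_mkcond.
  rewrite exchange_big -km big_distrr /= big_seq [RHS]big_seq.
  apply: eq_bigr => p hp; rewrite sum_if mulnC; congr (_ * _).
  by rewrite -(cnt6 hp); apply: eq_bigl => g; rewrite orthC.
rewrite -big_split /= big_seq (eq_bigr (fun=> s)) => [|g /kv <-]; last by rewrite addnC.
by rewrite -big_seq big_const_seq count_predT iter_addn -[size pts3]/31; lia.
Qed.

Let second_moment :
  \sum_(p <- pts3) vs p * vs p
  = (\sum_(g <- pts3) v g) * (\sum_(g <- pts3) v g) + 5 * \sum_(g <- pts3) v g * v g.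
Proof.
transitivity (\sum_(g <- pts3) v g * (\sum_(g <- pts3) v g + 5 * v g)).
  rewrite {1}/vs; under eq_bigr do rewrite big_distrl /= big_mkcond.
  rewrite exchange_big /= big_seq [RHS]big_seq; apply: eq_bigr => g hg.
  rewrite -big_mkcond -big_distrr /= -(plane_double v hg); congr (_ * _).
  by apply: eq_bigl => p; rewrite orthC.
under eq_bigr do rewrite mulnDr mulnCA.
by rewrite big_split /= -big_distrl -big_distrr.
Qed.

Let squares b : m + b = 6 * s ->
  \sum_(p <- pts3) vs p * vs p + 10 * b * m = 31 * (b * b) + 25 * m.
Proof.
move=> hb; have -> : 31 * (b * b) = \sum_(p <- pts3) b * b.
  by rewrite big_const_seq count_predT iter_addn -[size pts3]/31 addn0 mulnC.
rewrite -[in LHS]km -[in RHS]km !big_distrr -!big_split /= big_seq [RHS]big_seq.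
apply: eq_bigr => p hp; have := vsE hp; have := k1 hp.
case: (k p) => [|[|//]] _ e.
  have -> : vs p = b by lia.
  by rewrite !muln0.
have eb : b = vs p + 5 by lia.
by rewrite eb; lia.
Qed.

Let meet_point (g : V) : g \in pts3 -> 0 < kappa g ->
  exists p : V, [/\ p \in pts3, orth g p & k p = 1].
Proof.
rewrite lt0n /kappa sum_nat_seq_neq0 => hg /hasP[p hp /andP[gp kp]].
by exists p; split=> //; have := k1 hp; lia.
Qed.

Let v_le (g p : V) : g \in pts3 -> orth g p -> v g <= vs p.
Proof.
by move=> hg gp; apply: leq_sum_mem; rewrite // orthC.
Qed.

Let v_meet c g : 6 * s <= m + 5 + c -> g \in pts3 -> v g <= c \/ v g = s.
Proof.
move=> hc hg; have [k0|/(meet_point hg)[p [hp gp kp]]] := posnP (kappa g).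
  by right; rewrite -(kv hg) k0.
by left; apply: leq_trans (v_le hg gp) _; have := vsE hp; lia.
Qed.

Let v_pair (g h : V) : g \in pts3 -> h \in pts3 -> g != h ->
  exists2 p : V, p \in pts3 & v g + v h <= vs p.
Proof.
move=> hg hh gh.
have /hasP[p hp /andP[gp hp']] : has (fun p => orth g p && orth h p) pts3.
  move: h hh gh => h hh; apply/implyP; move: h hh; apply/allP.
  by move: g hg; apply/allP; vm_compute.
have hr : h \in rem g pts3 by rewrite mem_rem_uniq ?filter_uniq ?uniq_pts // inE eq_sym gh hh.
exists p => //; rewrite /vs (big_rem g hg) /= orthC gp leq_add2l.
by rewrite (big_rem h hr) /= orthC hp' leq_addr.
Qed.

(** The lines through a point of k have total deficiency 6 s - m - 5, those through any other point
    6 s - m. The former is negative for m = 2, 3, 8. Otherwise it is at most 2, so that only lines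
    missing k can have a larger deficiency, namely s; their number n is controlled by the second
    moment. *)
Lemma plane_excluded : m \notin [:: 2; 3; 7; 8; 12; 13; 17; 18].
Proof.
apply/negP; rewrite !inE => hm.
have m31 : m < 31 by lia.
have [p0 hp0 kp0] : exists2 p : V, p \in pts3 & k p = 0.
  have [/hasP[p hp /eqP kp]|/hasPn no] := boolP (has (fun p => k p == 0) pts3).
    by exists p.
  have : \sum_(p <- pts3) 1 <= m.
    rewrite -km big_seq [X in _ <= X]big_seq leq_sum // => p hp.
    by have := no p hp; lia.
  by rewrite sum1_size -[size pts3]/31; lia.
have [p1 hp1 kp1] : exists2 p : V, p \in pts3 & k p = 1.
  have : \sum_(p <- pts3) k p != 0 by rewrite km; lia.
  rewrite sum_nat_seq_neq0 => /hasP[p hp /andP[_ kp]].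
  by exists p => //; have := k1 hp; lia.
have vp0 := vsE hp0; have vp1 := vsE hp1.
have es : s = (m + 6) %/ 5 by [].
(* Cases m = 7 and 13: a line meeting k has deficiency 0, so the total 5 at a point off k would be a
   multiple of s. *)
have b5 : 6 * s = m + 5 -> 1 < s -> s < 5 -> False.
  move=> e s1 s5; have e5 : vs p0 = 5 by lia.
  have : s %| vs p0.
    rewrite /vs big_seq_cond dvdn_sum // => g /andP[hg _].
    have [|h|->] := v_meet (c := 0) _ hg; [lia | | exact: dvdnn].
    by have -> : v g = 0 by lia.
  by rewrite e5; have [->|[->|->]] : s = 2 \/ s = 3 \/ s = 4 by lia.
pose n := count (fun g => v g == s) pts3.
have vsq c : 6 * s <= m + 5 + c -> 0 < c < s ->
    \sum_(g <- pts3) v g * v g <= c * (\sum_(g <- pts3) v g) + s * (s - c) * n.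
  move=> hc cs.
  apply: leq_trans (_ : _ <= \sum_(g <- pts3)
      (c * v g + (if v g == s then s * (s - c) else 0))) _.
    rewrite big_seq [X in _ <= X]big_seq leq_sum // => g hg.
    by case: (v_meet hc hg) => h; case: eqP => h'; nia.
  by rewrite big_split -big_distrr -big_mkcond big_const_seq iter_addn addn0.
have vsq1 : 6 * s <= m + 6 -> 1 < s ->
    \sum_(g <- pts3) v g * v g = \sum_(g <- pts3) v g + s * (s - 1) * n.
  move=> hc cs.
  transitivity (\sum_(g <- pts3) (v g + (if v g == s then s * (s - 1) else 0))).
    rewrite big_seq [RHS]big_seq; apply: eq_bigr => g hg.
    by have [|h|h] := v_meet (c := 1) _ hg; [lia| |]; case: eqP => h'; nia.
  by rewrite big_split -big_mkcond big_const_seq iter_addn addn0.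
have two : 1 < n -> exists2 p : V, p \in pts3 & 2 * s <= vs p.
  move=> n2; pose r := [seq g <- pts3 | v g == s].
  have ur : uniq r by rewrite filter_uniq ?filter_uniq ?uniq_pts.
  have sr : 1 < size r by rewrite size_filter.
  have hr i : i < size r -> nth v0 r i \in pts3 /\ v (nth v0 r i) = s.
    by move=> /(mem_nth v0); rewrite mem_filter => /andP[/eqP].
  have [h0 e0] := hr 0 (ltnW sr); have [h1 e1'] := hr 1 sr.
  have [|p hp hv] := v_pair h0 h1; first by rewrite nth_uniq // ltnW.
  by exists p => //; rewrite mulSn mul1n -{1}e0 -e1'.
have sm := second_moment; have vt := vtot; have sq := squares.
set Sv := \sum_(g <- pts3) v g in vsq vsq1 sm vt.
set Svv := \sum_(g <- pts3) v g * v g in vsq vsq1 sm.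
set Svs := \sum_(p <- pts3) vs p * vs p in sm sq.
have [m12|m12] := eqVneq m 12; last first.
  (* For m = 17 the squares of deficiencies sum to 54 > 2 * 22 + 8, so two lines miss k; they meet
     in a point of total deficiency at least 8, above the maximum 7. *)
  have [m17|m17] := eqVneq m 17.
    have es4 : s = 4 by rewrite es m17.
    have Sv22 : Sv = 22 by lia.
    have Svs754 : Svs = 754 by have := sq 7; lia.
    have := vsq 2; rewrite es4 Sv22 => /(_ ltac:(lia) isT) le.
    have [|p hp] := two; first by move: sm; rewrite Sv22; lia.
    by have := vsE hp; lia.
  (* For m = 18 the second moment would give 46 = 16 + 12 n. *)
  have [m18|m18] := eqVneq m 18.
    have es4 : s = 4 by rewrite es m18.
    have Sv16 : Sv = 16 by lia.
    have Svs486 : Svs = 486 by have := sq 6; lia.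
    by have := vsq1; rewrite es4 => /(_ ltac:(lia) isT); lia.
  have [m8|m8] : (m = 7 \/ m = 13) \/ (m = 2 \/ m = 3 \/ m = 8) by lia.
    by apply: b5; lia.
  by lia.
have es3 : s = 3 by rewrite es m12.
have Sv21 : Sv = 21 by lia.
have Svs696 : Svs = 696 by have := sq 6; lia.
have n5 : n = 5 by have := vsq1; rewrite es3 => /(_ ltac:(lia) isT); lia.
(* For m = 12 five lines miss k. A point of a line g of deficiency 1 is on at most one of them, and
   on none if it belongs to k. As g carries two points of k, its six points would give 5 + 2 <=
   6. *)
have [g hg vg] : exists2 g : V, g \in pts3 & v g = 1.
  have [/hasP[g hg /eqP e]|/hasPn no] := boolP (has (fun g : V => v g == 1) pts3).
    by exists g.
  have : Sv = s * n; last by lia.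
  rewrite /Sv -iter_addn_0 -big_const_seq [RHS]big_mkcond /= big_seq [RHS]big_seq.
  apply: eq_bigr => g hg; have hn := no g hg.
  have [|h|->] := v_meet (c := 1) _ hg; [lia| |by rewrite eqxx].
  by case: eqP => h'; lia.
pose phi h := (v h == s : nat).
have pd : \sum_(p <- pts3 | orth g p) \sum_(h <- pts3 | orth p h) phi h = 5.
  rewrite plane_double // /phi vg es3 muln0 addn0 sum_bool sum1_count -[RHS]n5.
  by rewrite /n es3.
suff : \sum_(p <- pts3 | orth g p) (\sum_(h <- pts3 | orth p h) phi h + k p)
    <= \sum_(p <- pts3 | orth g p) 1.
  by rewrite big_split pd cnt6 //= -/(kappa g); have := kv hg; lia.
rewrite big_seq_cond [X in _ <= X]big_seq_cond leq_sum // => p /andP[hp gp].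
have le3 : 3 * \sum_(h <- pts3 | orth p h) phi h + 1 <= vs p.
  have pg : phi g = 0 by rewrite /phi vg es3.
  rewrite /vs (big_rem g hg) [X in _ <= X](big_rem g hg) /= orthC gp pg vg.
  rewrite add0n addnC leq_add2l big_distrr leq_sum //= => h _.
  by rewrite /phi; case: eqP => [->|//]; rewrite es3.
by have := vsE hp; have := k1 hp; lia.
Qed.
End Plane.

(** With the two dual bases exchanged, the frame built for the point h carries the plane [e4] to the
    plane h. *)
Lemma frame_plane k (h : V) : arc k -> h \in pts ->
  exists2 k', arc k' & plsum k' e4 = plsum k h.
Proof.
move=> ak /frame4P; set M := _.1; set N := _.2 => -[MN M4].
have NM : dualmat N M by rewrite dualmatC.
by exists (k \o mapply N); [apply: arc_map NM ak | rewrite (plsum_map _ NM) ?M4].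
Qed.

Lemma plsum_excluded k (h : V) : arc k -> h \in pts ->
  plsum k h \notin [:: 2; 3; 7; 8; 12; 13; 17; 18].
Proof.
move=> ak /(frame_plane ak)[k' ak' <-].
have in3 p : p \in pts3 -> p \in pts by rewrite mem_filter => /andP[].
apply: (@plane_excluded k') => [p /in3||g hg]; first exact: arc_le1.
  exact: big_filter.
rewrite big_filter_cond -[X in 5 * X](@eq_bigl _ _ _ _ _ (fun p => orth g p && orth e4 p)).
  by apply: (lnsum_plsum ak'); apply: pts_indep => //; [apply: in3|move: hg; case: eqP => // ->].
by move=> p; rewrite andbC.
Qed.

(** * No plane is disjoint from the arc *)

Definition W : Type := (F5 * F5 * F5)%type.

Definition wadd (u v : W) : W :=
  let: (a, b, c) := u in let: (x, y, z) := v in (a + x, b + y, c + z)%F5.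

(* [deg_lt n phi]: all n-fold finite differences of phi vanish. *)
Fixpoint deg_lt (n : nat) (phi : W -> F5) : Prop :=
  if n is n'.+1 then forall v, deg_lt n' (fun a => phi (wadd a v) - phi a)%F5
  else forall a, phi a = Z0.

Lemma deg_lt_ext n phi psi : phi =1 psi -> deg_lt n phi -> deg_lt n psi.
Proof.
elim: n phi psi => [|n IH] phi psi e /= d; first by move=> a; rewrite -e.
by move=> v; apply: IH (d v) => a; rewrite !e.
Qed.

Lemma deg_ltD n phi psi :
  deg_lt n phi -> deg_lt n psi -> deg_lt n (fun a => phi a + psi a)%F5.
Proof.
elim: n phi psi => [|n IH] phi psi /= d e; first by move=> a; rewrite d e.
by move=> v; apply: deg_lt_ext (IH _ _ (d v) (e v)) => a; ring.
Qed.

Lemma deg_ltZ n c phi : deg_lt n phi -> deg_lt n (fun a => c * phi a)%F5.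
Proof.
elim: n phi => [|n IH] phi /= d; first by move=> a; rewrite d; ring.
by move=> v; apply: deg_lt_ext (IH _ (d v)) => a; ring.
Qed.

Lemma deg_ltS n phi : deg_lt n phi -> deg_lt n.+1 phi.
Proof.
elim: n phi => [|n IH] phi d; first by move=> v a; rewrite !d.
by move=> v; apply: IH; apply: d.
Qed.

Lemma waddAC u v w : wadd (wadd u v) w = wadd (wadd u w) v.
Proof.
case: u => [[a b] c]; case: v => [[x y] z]; case: w => [[p q] r] /=.
by congr (_, _, _); ring.
Qed.

Lemma deg_lt_shift n phi v : deg_lt n phi -> deg_lt n (fun a => phi (wadd a v)).
Proof.
elim: n phi => [|n IH] phi /= d; first by move=> a.
by move=> u; apply: deg_lt_ext (IH _ (d u)) => a; rewrite waddAC.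
Qed.

(** Leibniz rule: the difference of l phi along v is l times the difference of phi, plus l(v) times
    a shift of phi. *)
Lemma deg_lt_lin n l phi : {morph l : a b / wadd a b >-> (a + b)%F5} ->
  deg_lt n phi -> deg_lt n.+1 (fun a => l a * phi a)%F5.
Proof.
move=> hl; elim: n phi => [|n IH] phi d.
  by move=> v a; rewrite !d; ring.
move=> v; apply: deg_lt_ext (deg_ltD (IH _ (d v)) (deg_ltZ (l v) (deg_lt_shift v d))).
by move=> a; rewrite hl; ring.
Qed.

Definition sum5 (v : W) (phi : W -> F5) (a : W) : F5 :=
  let a1 := wadd a v in let a2 := wadd a1 v in
  let a3 := wadd a2 v in let a4 := wadd a3 v in
  (phi a + phi a1 + phi a2 + phi a3 + phi a4)%F5.

(* In characteristic 5 the fourth difference is the sum over the whole line. *)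
Lemma deg_lt_sum5 n v phi : deg_lt (n + 4) phi -> deg_lt n (sum5 v phi).
Proof.
rewrite addnC => /(_ v v v v); apply: deg_lt_ext => a.
by rewrite /sum5 /=; ring.
Qed.

Fixpoint esym (l : seq F5) (j : nat) {struct l} : F5 :=
  if j is j'.+1 then
    if l is x :: l' then (esym l' j + x * esym l' j')%F5 else Z0
  else Z1.

Lemma esym0 l : esym l 0 = Z1.
Proof. by case: l. Qed.

Lemma esym_mid x l1 l2 j : esym (l1 ++ x :: l2) j = esym (x :: l1 ++ l2) j.
Proof.
elim: l1 j => [|y l1 IH] [|j] //=; rewrite !IH.
by case: j => [|j] /=; rewrite ?esym0; ring.
Qed.

Lemma perm_esym l l' : perm_eq l l' -> esym l =1 esym l'.
Proof.
elim: l l' => [|x l IH] l' h j; first by move: h; rewrite perm_sym => /perm_nilP ->.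
have : x \in l' by rewrite -(perm_mem h) mem_head.
move=> xl; move: h; case/splitPr: xl => l1 l2.
rewrite perm_sym perm_catC /= perm_cons perm_catC perm_sym => h.
rewrite esym_mid; case: j => [|j] //=.
by rewrite !(IH _ h).
Qed.

Lemma deg_lt_esym (S : seq V) j :
  deg_lt j.+1 (fun a : W => esym [seq dot (a, Z0) p | p <- S] j).
Proof.
have const c : deg_lt 1 (fun=> c) by move=> v a; ring.
have zero n : deg_lt n (fun=> Z0) by elim: n => // n IH; apply: deg_ltS.
elim: S j => [|p S IH] [|j]; [exact: const | exact: zero | exact: const |].
apply: deg_ltD; first exact: IH.
apply: deg_lt_lin; last exact: IH.
move=> [[a b] c] [[x y] z] /=; case: p => [[[p1 p2] p3] p4]; rewrite /dot; ring.
Qed.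

Fixpoint esym_step (x prev : F5) (P : seq F5) : seq F5 :=
  if P is c :: P' then (c + x * prev)%F5 :: esym_step x c P' else [::].

(** The coefficients up to degree 8 of the product of the 1 + x X, in one pass; the recursion of
    [esym] branches and is exponential. *)
Definition esyms (l : seq F5) : seq F5 :=
  foldr (fun x => esym_step x Z0) (Z1 :: nseq 8 Z0) l.

Lemma esym_stepE x prev P j : j < size P ->
  nth Z0 (esym_step x prev P) j
  = (nth Z0 P j + x * (if j is j'.+1 then nth Z0 P j' else prev))%F5.
Proof.
elim: P prev j => [|c P IH] prev [|j] //= hj.
by rewrite IH //; case: j hj.
Qed.

Lemma esymE l j : j < 9 -> esym l j = nth Z0 (esyms l) j.
Proof.
have sz P x prev : size (esym_step x prev P) = size P.
  by elim: P prev => //= c P IH prev; rewrite IH.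
have sz9 : size (esyms l) = 9 by elim: l => //= x l IH; rewrite sz.
elim: l j sz9 => [|x l IH] [|j] //= sz9 hj.
- by case: j hj => [|[|[|[|[|[|[|[|]]]]]]]].
- by rewrite sz in sz9; rewrite esym_stepE ?sz9 // -IH //= esym0; ring.
- by rewrite sz in sz9; rewrite esym_stepE ?sz9 // -!IH // ltnW.
Qed.

Definition blocks (n0 n1 n2 n3 n4 : nat) : seq F5 :=
  nseq n0 Z0 ++ nseq n1 Z1 ++ nseq n2 Z2 ++ nseq n3 Z3 ++ nseq n4 Z4.

(* If every value is taken at least three times by 21 elements, then
   \prod (X + l_i) is divisible by (X^5 - X)^3; this forces a relation between
   the fourth and the eighth coefficient. *)
Lemma esym_blocks (n0 n1 n2 n3 n4 : nat) :
  n0 + n1 + n2 + n3 + n4 = 6 ->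
  (esym (blocks (3 + n0) (3 + n1) (3 + n2) (3 + n3) (3 + n4)) 8
   + Z3 * esym (blocks (3 + n0) (3 + n1) (3 + n2) (3 + n3) (3 + n4)) 4 + Z1)%F5 = Z0.
Proof.
move=> e; rewrite !esymE //.
have : all (fun n0 => all (fun n1 => all (fun n2 => all (fun n3 =>
    if n0 + n1 + n2 + n3 <= 6 then
    let P := esyms (blocks (3 + n0) (3 + n1) (3 + n2) (3 + n3)
                           (3 + (6 - (n0 + n1 + n2 + n3)))) in
    (nth Z0 P 8 + Z3 * nth Z0 P 4 + Z1)%F5 == Z0 else true)
  (iota 0 7)) (iota 0 7)) (iota 0 7)) (iota 0 7) by vm_compute.
have [i0 i1 i2 i3] : [/\ n0 \in iota 0 7, n1 \in iota 0 7, n2 \in iota 0 7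
    & n3 \in iota 0 7] by rewrite !mem_iota; split; lia.
move=> /allP/(_ n0 i0)/allP/(_ n1 i1)/allP/(_ n2 i2)/allP/(_ n3 i3).
case: ifP => [_|]; last by lia.
have -> : 6 - (n0 + n1 + n2 + n3) = n4 by lia.
by move=> /eqP.
Qed.

Lemma esym_relation (l : seq F5) : size l = 21 ->
  (forall c, 3 <= count_mem c l) ->
  (esym l 8 + Z3 * esym l 4 + Z1)%F5 = Z0.
Proof.
move=> sz hc; pose n c := count_mem c l - 3.
have sum21 : count_mem Z0 l + count_mem Z1 l + count_mem Z2 l
    + count_mem Z3 l + count_mem Z4 l = 21.
  by rewrite -sz; elim: (l) => //= x s <-; case: x; rewrite !eqE /=; lia.
have := @esym_blocks (n Z0) (n Z1) (n Z2) (n Z3) (n Z4).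
have hn c : 3 + n c = count_mem c l by rewrite /n; have := hc c; lia.
rewrite !hn => h.
have pm : perm_eq l (blocks (count_mem Z0 l) (count_mem Z1 l) (count_mem Z2 l)
                            (count_mem Z3 l) (count_mem Z4 l)).
  apply/allP => x _ /=; apply/eqP; rewrite /blocks !count_cat !count_nseq.
  by case: x; rewrite /= ?eqE /=; lia.
rewrite !(perm_esym pm); apply: h; rewrite /n.
have := hc Z0; have := hc Z1; have := hc Z2; have := hc Z3; have := hc Z4; lia.
Qed.

(* Otherwise the points outside the arc form a set of 21 affine points that every
   affine plane meets at least three times, so esym_relation holds in all nonzero
   directions and fails in the zero one; a function with a single nonzero value
   on F_5^3 has degree at least 12, but the relation has degree less than 12. *)
Lemma plsum_neq0 k (h : V) : arc k -> h \in pts -> plsum k h != 0.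
Proof.
move=> ak0 /(frame_plane ak0)[{ak0 h}k' ak <-]; apply/negP => /eqP pl0.
have kin p : p \in pts -> orth e4 p -> k' p = 0.
  move=> hp h4; move/eqP: pl0; rewrite /plsum sum_nat_seq_eq0 => /allP/(_ p hp).
  by rewrite h4 => /eqP.
have affine (P : pred V) :
    \sum_(p <- pts | P p && ~~ orth e4 p) k' p = \sum_(p <- pts | P p) k' p.
  rewrite big_mkcondr big_seq_cond [RHS]big_seq_cond; apply: eq_bigr => p.
  by case/andP=> hp _; case: ifP => // /negbFE /(kin p hp) ->.
pose S := [seq p <- pts | ~~ orth e4 p & k' p == 0].
have szS (P : pred V) : count P S + \sum_(p <- pts | P p) k' p
    = \sum_(p <- pts | P p && ~~ orth e4 p) 1.
  rewrite -(affine P) count_filter -sum1_count big_mkcond [X in _ + X]big_mkcond.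
  rewrite -big_split [RHS]big_mkcond big_seq [RHS]big_seq; apply: eq_bigr => p hp /=.
  have := arc_le1 ak hp.
  by case: (P p); case: (orth e4 p); case: (k' p) => [|[|]].
have size21 : size S = 21.
  have := szS predT; rewrite count_predT (arc_tot ak).
  have -> : \sum_(p <- pts | predT p && ~~ orth e4 p) 1 = 125.
    by rewrite sum1_count; apply/eqP; vm_compute.
  by lia.
have cnt3 (a : W) c : a != (Z0, Z0, Z0) ->
    3 <= count_mem c [seq dot (a, Z0) p | p <- S].
  case: a => [[x y] z] ha; pose h := (x, y, z, (- c)%F5) : V.
  have h0 : h != v0 by apply: contraNneq ha => -[-> -> ->].
  have := szS (orth h); have := arc_pl ak h0; rewrite /plsum.
  have -> : \sum_(p <- pts | orth h p && ~~ orth e4 p) 1 = 25.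
    rewrite sum1_count; apply/eqP.
    have /(_ h)/implyP : forall v : V, (let: (x, y, z, t) := v in (x, y, z) != (Z0, Z0, Z0)) ==>
        (count (fun p => orth v p && ~~ orth e4 p) pts == 25).
      by apply: V_forall; vm_compute.
    exact.
  suff -> : count_mem c [seq dot (x, y, z, Z0) p | p <- S] = count (orth h) S by lia.
  rewrite count_map; apply: eq_in_count => p; rewrite mem_filter => /andP[/andP[p4 _] hp] /=.
  have : (p.2 == Z1) by move: p hp p4 => p hp; apply/implyP; move: p hp; apply/allP; vm_compute.
  case: p {hp p4} => [[[p q] r] w] /= /eqP ->; rewrite /orth /h /dot.
  set u := (x * p)%F5; set v := (y * q)%F5; set w' := (z * r)%F5.
  rewrite (_ : (u + v + w' + Z0 * Z1 = u + v + w')%F5); last by ring.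
  rewrite (_ : (u + v + w' + - c * Z1 = u + v + w' + - c)%F5); last by ring.
  by move: (u + v + w')%F5; case: (c); case.
have rel (a : W) :
  (esym [seq dot (a, Z0) p | p <- S] 8 + Z3 * esym [seq dot (a, Z0) p | p <- S] 4 + Z1)%F5
  = if a == (Z0, Z0, Z0) then Z1 else Z0.
  have [->|ha] := eqVneq a (Z0, Z0, Z0); last first.
    by apply: esym_relation => [|c]; rewrite ?size_map //; apply: cnt3.
  have -> : [seq dot (Z0, Z0, Z0, Z0) p | p <- S] = nseq (size S) Z0.
    by elim: (S) => // p s; rewrite map_cons => ->; rewrite [dot _ _]dot0.
  by rewrite !esymE // size21; vm_compute.
have d12 : deg_lt 12 (fun a : W => if a == (Z0, Z0, Z0) then Z1 else Z0).
  do 3!apply: deg_ltS.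
  have d9 : deg_lt 9 (fun=> Z1) by do 8!apply: deg_ltS; move=> v a; ring.
  have d4 := deg_lt_esym S 4; have d8 := deg_lt_esym S 8.
  have {}d4 := deg_ltS (deg_ltS (deg_ltS (deg_ltS d4))).
  apply: deg_lt_ext (deg_ltD (deg_ltD d8 (deg_ltZ Z3 d4)) d9).
  by move=> a; rewrite -rel.
(* The sums along the three axes lower 12 to 0 and amount to the sum over all of F_5^3, which is 1
   but would have to vanish. *)
have := deg_lt_sum5 (n := 0) (Z0, Z0, Z1) (deg_lt_sum5 (n := 4) (Z0, Z1, Z0)
  (deg_lt_sum5 (n := 8) (Z1, Z0, Z0) d12)).
by move/(_ (Z0, Z0, Z0)).
Qed.

(** * Moments of the weights *)

Definition wt (k : V -> nat) (h : V) : nat := 22 - plsum k h.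

Definition tt (k : V -> nat) (h : V) : nat := wt k h %% 5.

Definition uu (k : V -> nat) (h : V) : nat := wt k h %/ 5.

Definition tP (k : V -> nat) (p : V) : nat := \sum_(h <- pts | orth p h) tt k h.

Definition uP (k : V -> nat) (p : V) : nat := \sum_(h <- pts | orth p h) uu k h.

Lemma sum_point (F G : V -> nat) :
  \sum_(h <- pts) F h * \sum_(p <- pts | orth h p) G p
  = \sum_(p <- pts) G p * \sum_(h <- pts | orth p h) F h.
Proof.
under eq_bigr do rewrite big_distrr /= big_mkcond.
rewrite exchange_big /=; apply: eq_bigr => p _.
rewrite -big_mkcond [RHS]big_distrr /=; apply: eq_big => h; first exact: orthC.
by rewrite mulnC.
Qed.

Section Weights.
Variables (k : V -> nat) (ak : arc k).

Lemma wtE (h : V) : h != v0 -> wt k h + plsum k h = 22.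
Proof. by move=> /(arc_pl ak); rewrite /wt; lia. Qed.

Lemma wt_tu h : wt k h = tt k h + 5 * uu k h.
Proof. by rewrite /tt /uu; lia. Qed.

Lemma wt_allowed (h : V) : h \in pts ->
  wt k h \in [:: 0; 1; 2; 3; 6; 7; 8; 11; 12; 13; 16; 17; 18; 21].
Proof.
move=> hh; have := wtE (pts_neq0 hh); have := plsum_neq0 ak hh.
have := plsum_excluded ak hh; rewrite !inE; lia.
Qed.

Lemma wt_check (P : pred nat) (h : V) :
  all P [:: 0; 1; 2; 3; 6; 7; 8; 11; 12; 13; 16; 17; 18; 21] -> h \in pts -> P (wt k h).
Proof. by move=> /allP hP /wt_allowed; apply: hP. Qed.

Lemma tt_le3 (h : V) : h \in pts -> tt k h <= 3.
Proof. exact: (@wt_check (fun w => w %% 5 <= 3)). Qed.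

Lemma uu_tt (h : V) : h \in pts -> 0 < uu k h -> 0 < tt k h.
Proof.
by move=> hh; apply/implyP; move: hh; apply: (@wt_check (fun w => (0 < w %/ 5) ==> (0 < w %% 5))).
Qed.

Lemma sum_plsum : \sum_(h <- pts) plsum k h = 3224.
Proof.
rewrite /plsum; under eq_bigr do rewrite big_mkcond.
rewrite exchange_big -[RHS]/(31 * 104) -(arc_tot ak) big_distrr /= big_seq [RHS]big_seq.
apply: eq_bigr => p hp; rewrite sum_if mulnC; congr (_ * _).
by rewrite -(count_orth (pts_neq0 hp)); apply: eq_bigl => h; rewrite orthC.
Qed.

Lemma sum_wt : \sum_(h <- pts) wt k h = 208.
Proof.
have : \sum_(h <- pts) (wt k h + plsum k h) = \sum_(h <- pts) 22.
  by rewrite big_seq [RHS]big_seq; apply: eq_bigr => h /pts_neq0 /wtE.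
rewrite big_split /= sum_plsum big_const_seq count_predT size_pts iter_addn; lia.
Qed.

Lemma point_wt (p : V) : p \in pts ->
  \sum_(h <- pts | orth p h) wt k h + 25 * k p = 58.
Proof.
move=> hp; have := point_plsum ak hp.
have : \sum_(h <- pts | orth p h) (wt k h + plsum k h) = \sum_(h <- pts | orth p h) 22.
  rewrite big_seq_cond [RHS]big_seq_cond; apply: eq_bigr => h /andP[/pts_neq0 hh _].
  exact: wtE.
rewrite big_split /= big_const_seq -sum1_count count_orth ?pts_neq0 // iter_addn; lia.
Qed.

Lemma tP_uP (p : V) : p \in pts -> tP k p + 5 * uP k p + 25 * k p = 58.
Proof.
move=> /point_wt <-; congr (_ + _); rewrite /tP /uP big_distrr -big_split /=.
by apply: eq_bigr => h _; rewrite -wt_tu.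
Qed.

(** As k is 0 or 1, each point of the arc contributes 624 + 25 = 649 to the sum of the squares of
    [plsum]; the rest is the expansion of (22 - plsum)^2. *)
Lemma sum_wt2 : \sum_(h <- pts) wt k h * wt k h = 1144.
Proof.
have e1 : \sum_(h <- pts) plsum k h * plsum k h = 649 * 104.
  transitivity (\sum_(p <- pts) 649 * k p); last first.
    by rewrite -(arc_tot ak) big_distrr.
  transitivity (\sum_(p <- pts) k p * \sum_(h <- pts | orth p h) plsum k h).
    exact: sum_point.
  rewrite big_seq [RHS]big_seq; apply: eq_bigr => p hp; rewrite (point_plsum ak hp).
  by have := arc_le1 ak hp; case: (k p) => [|[|]].
have : \sum_(h <- pts) (wt k h * wt k h + 44 * plsum k h)
    = \sum_(h <- pts) (484 + plsum k h * plsum k h).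
  rewrite big_seq [RHS]big_seq; apply: eq_bigr => h /pts_neq0 /wtE.
  by move: (wt k h) (plsum k h) => w s; nia.
have e44 : \sum_(h <- pts) 44 * plsum k h = 44 * 3224 by rewrite -sum_plsum big_distrr.
rewrite big_split [X in _ = X]big_split /= e44 e1 big_const_seq count_predT size_pts iter_addn.
lia.
Qed.

Lemma sum_uu_plsum :
  \sum_(h <- pts) uu k h * plsum k h = \sum_(p <- pts) k p * uP k p.
Proof. exact: sum_point. Qed.

(* If every point of the arc had tP > 23, all planes would have weight at most
   8, at most 7 of them more than 3, and sum_wt2 would fail. *)
Lemma exists_light : exists p : V, [/\ p \in pts, k p = 1 & tP k p <= 23].
Proof.
have [/hasP[p hp /andP[/eqP k1 le]]|/hasPn no] :=
  boolP (has (fun p : V => (k p == 1) && (tP k p <= 23)) pts); first by exists p.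
exfalso.
have u1 p : p \in pts -> k p = 1 -> uP k p <= 1.
  move=> hp k1; have := no p hp; rewrite k1 /=; have := tP_uP hp; lia.
have w8 h : h \in pts -> wt k h <= 8.
  move=> hh; have : plsum k h != 0 by apply: plsum_neq0.
  rewrite sum_nat_seq_neq0 => /hasP[p hp /andP[hp' kp]].
  have k1 : k p = 1 by have := arc_le1 ak hp; lia.
  have := leq_trans (leq_sum_mem (uu k) hh _) (u1 p hp k1); rewrite orthC => /(_ hp').
  by apply/implyP; apply: (@wt_check (fun w => (w %/ 5 <= 1) ==> (w <= 8))).
have heavy : \sum_(h <- pts) uu k h * plsum k h <= 104.
  rewrite -(arc_tot ak).
  rewrite sum_uu_plsum.
  rewrite big_seq [X in _ <= X]big_seq leq_sum // => p hp.
  have := arc_le1 ak hp; case: (k p) (u1 p hp) => [|[|//]] // /(_ erefl); lia.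
(* An allowed weight w <= 8 satisfies w^2 <= 3 w + 3 u (22 - w). Summation bounds the second moment
   by 624 + 312 = 936, short of 1144. *)
have : \sum_(h <- pts) wt k h * wt k h
    <= \sum_(h <- pts) (3 * wt k h + 3 * (uu k h * plsum k h)).
  rewrite big_seq [X in _ <= X]big_seq leq_sum // => h hh.
  have -> : plsum k h = 22 - wt k h by have := wtE (pts_neq0 hh); lia.
  have := w8 h hh; apply/implyP.
  by apply: (@wt_check (fun w => (w <= 8) ==> (w * w <= 3 * w + 3 * (w %/ 5 * (22 - w))))).
rewrite sum_wt2 big_split.
have -> : \sum_(h <- pts) 3 * wt k h = 3 * 208 by rewrite -sum_wt big_distrr.
have -> : \sum_(h <- pts) 3 * (uu k h * plsum k h)
    = 3 * \sum_(h <- pts) uu k h * plsum k h by rewrite big_distrr.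
by move=> /leq_trans/(_ (leq_add (leqnn _) (leq_mul (leqnn 3) heavy))).
Qed.

End Weights.

(** * The residues are the values of a quartic form *)

Definition form4 : Type := (F5 * F5 * F5 * F5 * F5)%type.
Definition form3 : Type := (F5 * F5 * F5 * F5)%type.
Definition form2 : Type := (F5 * F5 * F5)%type.
Definition form1 : Type := (F5 * F5)%type.
Definition slice : Type := (form3 * form2 * form1 * F5)%type.

(* A quartic form in x, y, z, t is stored as
   (g, A, B, m2, m1, m1', n1, n2, n3): its restriction to the line z = t = 0 is
   the binary form g, to the affine planes (z, t) = (1, 0) and (0, 1) it is g
   plus the cubic polynomials A and B, and the remaining terms are
   z t m2 + z^2 t m1 + z t^2 m1' + n1 z^3 t + n2 z^2 t^2 + n3 z t^3. *)
Definition quartic : Type :=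
  (form4 * slice * slice * form2 * form1 * form1 * F5 * F5 * F5)%type.

Definition row (g : form4) (s : slice) (y : F5) : form4 :=
  let: (q40, q31, q22, q13, q04) := g in
  let: (c30, c21, c12, c03, (c20, c11, c02), (c10, c01), c00) := s in
  (q40, c30 + y * q31, c20 + y * (c21 + y * q22),
   c10 + y * (c11 + y * (c12 + y * q13)),
   c00 + y * (c01 + y * (c02 + y * (c03 + y * q04))))%F5.

Definition horner (r : form4) (x : F5) : F5 :=
  let: (r4, r3, r2, r1, r0) := r in
  (r0 + x * (r1 + x * (r2 + x * (r3 + x * r4))))%F5.

Definition slice_at (q : quartic) (z t : F5) : slice :=
  let: (g, A, B, (m20, m11, m02), (l10, l01), (k10, k01), n1, n2, n3) := q in
  let: (a30, a21, a12, a03, (a20, a11, a02), (a10, a01), a00) := A in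
  let: (b30, b21, b12, b03, (b20, b11, b02), (b10, b01), b00) := B in
  let zz := (z * z)%F5 in let zt := (z * t)%F5 in let tt := (t * t)%F5 in
  let zzz := (zz * z)%F5 in let zzt := (zz * t)%F5 in
  let ztt := (z * tt)%F5 in let ttt := (tt * t)%F5 in
  (z * a30 + t * b30, z * a21 + t * b21, z * a12 + t * b12, z * a03 + t * b03,
   (zz * a20 + zt * m20 + tt * b20, zz * a11 + zt * m11 + tt * b11,
    zz * a02 + zt * m02 + tt * b02),
   (zzz * a10 + zzt * l10 + ztt * k10 + ttt * b10,
    zzz * a01 + zzt * l01 + ztt * k01 + ttt * b01),
   zz * zz * a00 + zzz * t * n1 + zz * tt * n2 + z * ttt * n3 + tt * tt * b00)%F5.

Definition qline (q : quartic) : form4 :=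
  let: (g, A, B, m2, m1, m1', n1, n2, n3) := q in g.

Definition evq (q : quartic) (h : V) : F5 :=
  let: (x, y, z, t) := h in horner (row (qline q) (slice_at q z t) y) x.

Fixpoint inj (n : nat) : F5 := if n is n'.+1 then (Z1 + inj n')%F5 else Z0.

Lemma injD m n : inj (m + n) = (inj m + inj n)%F5.
Proof.
elim: m => [|m IH]; first by rewrite add0n /=; ring.
by rewrite addSn /= IH; ring.
Qed.

Lemma inj_mod n : inj (n %% 5) = inj n.
Proof.
have inj5 m : inj (m * 5) = Z0 by elim: m => // m IH; rewrite mulSn injD IH.
by rewrite {2}(divn_eq n 5) injD inj5; case: inj.
Qed.

Definition pow4 (a : F5) : F5 := (a * a * (a * a))%F5.

Fixpoint power_sum (k : V -> nat) (l : seq V) (h : V) : F5 :=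
  if l is p :: l' then (inj (k p) * pow4 (dot h p) + power_sum k l' h)%F5 else Z0.

Lemma power_sum_quartic k l : exists q, forall h, power_sum k l h = evq q h.
Proof.
elim: l => [|[[[a b] c] d] l [q IH]].
  pose z2 := (Z0, Z0, Z0); pose z1 := (Z0, Z0); pose zs := (Z0, Z0, Z0, Z0, z2, z1, Z0).
  exists (Z0, Z0, Z0, Z0, Z0, zs, zs, z2, z1, z1, Z0, Z0, Z0).
  by move=> [[[x y] z] t]; rewrite /evq /slice_at /row /horner /=; ring.
case: q IH => [[[[[[[[g A] B] m2] l1] k1] n1] n2] n3] IH.
case: g IH => [[[[q40 q31] q22] q13] q04] IH.
case: A IH => [[[[[[a30 a21] a12] a03] [[a20 a11] a02]] [a10 a01]] a00] IH.
case: B IH => [[[[[[b30 b21] b12] b03] [[b20 b11] b02]] [b10 b01]] b00] IH.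
case: m2 IH => [[m20 m11] m02] IH; case: l1 IH => [l10 l01] IH.
case: k1 IH => [k10 k01] IH.
pose K := inj (k (a, b, c, d)).
(* The numerical factors are the multinomial coefficients 4, 6, 12 and 24 modulo 5. *)
exists ((q40 + K * (a*a*a*a), q31 + Z4 * K * (a*a*a*b), q22 + K * (a*a*b*b),
  q13 + Z4 * K * (a*b*b*b), q04 + K * (b*b*b*b)),
 (a30 + Z4 * K * (a*a*a*c), a21 + Z2 * K * (a*a*b*c), a12 + Z2 * K * (a*b*b*c),
  a03 + Z4 * K * (b*b*b*c),
  (a20 + K * (a*a*c*c), a11 + Z2 * K * (a*b*c*c), a02 + K * (b*b*c*c)),
  (a10 + Z4 * K * (a*c*c*c), a01 + Z4 * K * (b*c*c*c)), a00 + K * (c*c*c*c)),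
 (b30 + Z4 * K * (a*a*a*d), b21 + Z2 * K * (a*a*b*d), b12 + Z2 * K * (a*b*b*d),
  b03 + Z4 * K * (b*b*b*d),
  (b20 + K * (a*a*d*d), b11 + Z2 * K * (a*b*d*d), b02 + K * (b*b*d*d)),
  (b10 + Z4 * K * (a*d*d*d), b01 + Z4 * K * (b*d*d*d)), b00 + K * (d*d*d*d)),
 (m20 + Z2 * K * (a*a*c*d), m11 + Z4 * K * (a*b*c*d), m02 + Z2 * K * (b*b*c*d)),
 (l10 + Z2 * K * (a*c*c*d), l01 + Z2 * K * (b*c*c*d)),
 (k10 + Z2 * K * (a*c*d*d), k01 + Z2 * K * (b*c*d*d)),
 n1 + Z4 * K * (c*c*c*d), n2 + K * (c*c*d*d), n3 + Z4 * K * (c*d*d*d))%F5.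
move=> [[[x y] z] t]; rewrite /power_sum -/power_sum IH -/K.
by rewrite /evq /qline /slice_at /row /horner /pow4 /dot; ring.
Qed.

Lemma inj_plsum k l h :
  (inj (\sum_(p <- l | orth h p) k p) + power_sum k l h)%F5 = inj (\sum_(p <- l) k p).
Proof.
elim: l => [|p l IH]; first by rewrite !big_nil.
rewrite !big_cons /= [in RHS]injD -IH /orth.
by case: (dot h p); rewrite /pow4 /= ?injD; ring.
Qed.

(** The form has value 104 - (22 - w), which is t + 2 modulo 5, so t is recovered by subtracting
    2. *)
Definition tv (r : F5) : nat :=
  match r with Z2 => 0 | Z3 => 1 | Z4 => 2 | Z0 => 3 | Z1 => 4 end.

Lemma arc_quartic k : arc k ->
  exists q, forall h : V, h \in pts -> tt k h = tv (evq q h) /\ evq q h <> Z1.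
Proof.
move=> ak; have [q hq] := power_sum_quartic k pts.
exists q => h hh; have := inj_plsum k pts h; rewrite (arc_tot ak) -/(plsum k h) hq.
have := congr1 inj (wtE ak (pts_neq0 hh)); rewrite injD -inj_mod -/(tt k h).
have := tt_le3 ak hh; move: (tt k h) (inj (plsum k h)) (evq q h) => n a b.
by case: n => [|[|[|[|]]]] //= _; case: a; case: b.
Qed.

(** * Normal position *)

Lemma plsumZ k (c : F5) (h : V) : c != Z0 -> plsum k (vscale c h) = plsum k h.
Proof. by move=> hc; apply: eq_bigl => p; apply: orthZl. Qed.

Lemma ttZ k (c : F5) (h : V) : c != Z0 -> tt k (vscale c h) = tt k h.
Proof. by move=> hc; rewrite /tt /wt plsumZ. Qed.

Lemma tPZ k (c : F5) (p : V) : c != Z0 -> tP k (vscale c p) = tP k p.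
Proof. by move=> hc; apply: eq_bigl => h; apply: orthZl. Qed.

Lemma wt_map M N k h : dualmat M N -> arc k ->
  wt (k \o mapply M) h = wt k (mapply N h).
Proof. by move=> MN ak; rewrite /wt (plsum_map _ MN). Qed.

Lemma tt_map M N k h : dualmat M N -> arc k ->
  tt (k \o mapply M) h = tt k (mapply N h).
Proof. by move=> MN ak; rewrite /tt (wt_map _ MN). Qed.

Lemma tP_map M N k p : dualmat M N -> arc k ->
  tP (k \o mapply M) p = tP k (mapply M p).
Proof.
move=> MN ak; have NM : dualmat N M by rewrite dualmatC.
rewrite /tP -[RHS](mapply_sum NM) => [|c v|c v]; [|exact: orthZr|exact: ttZ].
apply: eq_big => h; last by rewrite (tt_map _ MN).
by rewrite orthC [RHS]orthC /orth (dot_mapply _ _ MN).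
Qed.

Lemma lnsum_map M N k h h' : dualmat M N -> arc k ->
  lnsum (k \o mapply M) h h' = lnsum k (mapply N h) (mapply N h').
Proof.
move=> MN ak; rewrite /lnsum -[RHS](mapply_sum MN) => [|c v hc|c v].
- by apply: eq_bigl => p; rewrite /orth !(dot_mapply _ _ MN).
- by rewrite !orthZr.
- exact: (arc_inv ak).
Qed.

(* The point e4 belongs to the arc and minimises tP there; e3 is another point
   of the arc, on a line through e4 meeting the complement in one point. *)
Record pointed (k : V -> nat) : Prop := Pointed {
  pointed_arc : arc k;
  pointed_e3 : k e3 = 1;
  pointed_e4 : k e4 = 1;
  pointed_line : lnsum k e2 e1 = 5;
  pointed_light : tP k e4 <= 23;
  pointed_min : forall p : V, p != v0 -> k p = 1 -> tP k e4 <= tP k p }.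

Lemma pointed_map M N k (c d : F5) : dualmat M N -> c != Z0 -> d != Z0 ->
  mapply M e3 = vscale c e3 -> mapply M e4 = vscale d e4 ->
  lnsum k (mapply N e2) (mapply N e1) = lnsum k e2 e1 ->
  pointed k -> pointed (k \o mapply M).
Proof.
move=> MN hc hd M3 M4 ln [ak k3 k4 l5 li mi]; split=> /=.
- exact: arc_map MN ak.
- by rewrite M3 (arc_inv ak).
- by rewrite M4 (arc_inv ak).
- by rewrite (lnsum_map _ _ MN) // ln.
- by rewrite (tP_map _ MN) // M4 tPZ.
- by move=> p hp kp; rewrite !(tP_map _ MN) // M4 tPZ // mi // (mapply_neq0 MN).
Qed.

Lemma exists_pointed k : arc k -> exists k', pointed k'.
Proof.
move=> ak.
have exn : exists n, has (fun p : V => (k p == 1) && (tP k p == n)) pts.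
  have [p [hp kp _]] := exists_light ak.
  by exists (tP k p); apply/hasP; exists p; rewrite ?kp ?eqxx.
case: (ex_minnP exn) => n /hasP[p hp /andP[/eqP kp /eqP tp]] mn.
have lt : tP k p <= 23.
  have [p' [hp' kp' le]] := exists_light ak; rewrite tp (leq_trans _ le) // mn //.
  by apply/hasP; exists p'; rewrite ?kp' ?eqxx.
have min v : v != v0 -> k v = 1 -> tP k p <= tP k v.
  move=> hv kv; rewrite tp mn //; apply/hasP; exists (vnorm v); first exact: vnorm_pts.
  by rewrite (arc_norm ak) // kv; case: (vnormE hv) => c hc ->; rewrite tPZ ?eqxx.
have [MN M4] := frame4P hp; set M := _.1 in MN M4; set N := _.2 in MN.
pose k1 := k \o mapply M; have ak1 : arc k1 := arc_map MN ak.
have k14 : k1 e4 = 1 by rewrite /k1 /= M4.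
have lt1 : tP k1 e4 <= 23 by rewrite (tP_map _ MN) // M4.
have min1 v : v != v0 -> k1 v = 1 -> tP k1 e4 <= tP k1 v.
  by move=> hv kv; rewrite !(tP_map _ MN) // M4 min // (mapply_neq0 MN).
have [q hq s5] := tangent ak1 k14; have ln := spsum_lnsum ak1 hq.
have [MN3 M34 M33] := frame3P hq; set M3 := _.1 in MN3 M34 M33 ln; set N3 := _.2 in MN3.
pose k2 := k1 \o mapply M3; have ak2 : arc k2 := arc_map MN3 ak1.
have k24 : k2 e4 = 1 by rewrite /k2 /= M34.
(* The line x = y = 0 now carries five points of the arc; one of the four other than [e4] is then
   sheared onto [e3]. *)
have [s k2s] : exists s : F5, k2 (Z0, Z0, Z1, s) = 1.
  have : \sum_(s <- F5s) k1 (vadd q (vscale s e4)) != 0.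
    by move: s5; rewrite /spsum big_cons big_map k14; lia.
  rewrite sum_nat_seq_neq0 => /hasP[s _ /= ks]; exists s.
  have es : (Z0, Z0, Z1, s) = vadd e3 (vscale s e4) by case: s {ks}.
  have s0 : (Z0, Z0, Z1, s) != v0 by case: (s).
  have := arc_le1 ak2 (vnorm_pts s0); rewrite (arc_norm ak2) //.
  have -> : k2 (Z0, Z0, Z1, s) = k1 (vadd q (vscale s e4)).
    by rewrite es /k2 /comp mapplyD mapplyZ M33 M34.
  by move: ks; move: (k1 _) => [|[|]].
pose M5 : mat := (e1, e2, (Z0, Z0, Z1, s), e4).
pose N5 : mat := (e1, e2, e3, (Z0, Z0, - s, Z1)%F5).
have MN5 : dualmat M5 N5 by rewrite /M5 /N5; case: (s).
exists (k2 \o mapply M5).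
have M54 : mapply M5 e4 = e4 by rewrite /M5; case: (s).
have M53 : mapply M5 e3 = (Z0, Z0, Z1, s) by rewrite /M5; case: (s).
split.
- exact: arc_map MN5 ak2.
- by rewrite /comp M53.
- by rewrite /comp M54.
- by rewrite (lnsum_map _ _ MN5) // -s5 ln; congr lnsum; case: (s).
- by rewrite (tP_map _ MN5) // M54 (tP_map _ MN3) // M34.
- move=> v hv; rewrite /comp => kv; rewrite !(tP_map _ MN5) // M54 !(tP_map _ MN3) // M34.
  by apply: min1 kv; rewrite (mapply_neq0 MN3) // (mapply_neq0 MN5).
Qed.

(** * Residues on the pencil of planes through [e3] and [e4] *)

Definition line_vals (k : V -> nat) : seq nat :=
  [seq tt k h | h <- pencil e2 e1].

Definition f5nat (a : F5) : nat :=
  match a with Z0 => 0 | Z1 => 1 | Z2 => 2 | Z3 => 3 | Z4 => 4 end.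

(** The index follows the order of [pencil e2 e1]: the plane (1, 0) comes first, then the planes (s,
    1). *)
Definition line_val (l : seq nat) (x y : F5) : nat :=
  nth 0 l (if is0 y then 0 else (f5nat (x * inv y)%F5).+1).

Definition gl2 : seq (F5 * F5 * F5 * F5) :=
  [seq m <- flatten [seq flatten [seq flatten [seq [seq (a, b, c, d)
     | d <- F5s] | c <- F5s] | b <- F5s] | a <- F5s]
   | let: (a, b, c, d) := m in ~~ is0 (a * d - b * c)%F5].

Definition line_act (m : F5 * F5 * F5 * F5) (l : seq nat) : seq nat :=
  let: (a, b, c, d) := m in
  line_val l a b :: [seq line_val l (s * a + c)%F5 (s * b + d)%F5 | s <- F5s].

(* Representatives, up to GL_2(5), of the residues with total 3 on a line of
   planes. *)
Definition patterns : seq (seq nat) :=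
  [:: [:: 0; 3; 0; 0; 0; 0]; [:: 0; 2; 1; 0; 0; 0]; [:: 0; 1; 1; 0; 0; 1]].

Lemma line_act_pattern l : size l = 6 -> sumn l = 3 ->
  has (fun m => line_act m l \in patterns) gl2.
Proof.
case: l => [|a0 [|a1 [|a2 [|a3 [|a4 [|a5 [|]]]]]]] // _ e; rewrite [sumn _]/= in e.
have : all (fun a0 => all (fun a1 => all (fun a2 => all (fun a3 => all (fun a4 =>
    if a0 + a1 + a2 + a3 + a4 <= 3 then
      let l := [:: a0; a1; a2; a3; a4; 3 - (a0 + a1 + a2 + a3 + a4)] in
      has (fun m => line_act m l \in patterns) gl2
    else true) (iota 0 4)) (iota 0 4)) (iota 0 4)) (iota 0 4)) (iota 0 4).
  by vm_compute.
have [i0 i1 i2 i3] : [/\ a0 \in iota 0 4, a1 \in iota 0 4, a2 \in iota 0 4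
    & a3 \in iota 0 4] by rewrite !mem_iota; split; lia.
have i4 : a4 \in iota 0 4 by rewrite mem_iota; lia.
move=> /allP/(_ _ i0)/allP/(_ _ i1)/allP/(_ _ i2)/allP/(_ _ i3)/allP/(_ _ i4).
have -> : a0 + a1 + a2 + a3 + a4 <= 3 by lia.
by have -> : 3 - (a0 + a1 + a2 + a3 + a4) = a5 by lia.
Qed.

Lemma line_valE k (x y : F5) : (x, y) != (Z0, Z0) ->
  tt k (x, y, Z0, Z0) = line_val (line_vals k) x y.
Proof.
move=> hxy; rewrite /line_val.
have [/is0P y0|/is0P y0] := boolP (is0 y).
  have x0 : x != Z0 by apply: contraNneq hxy => ->; rewrite y0.
  by rewrite /= -(ttZ k e1 x0) y0; congr tt; case: (x).
have {}y0 : y != Z0 by apply/eqP.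
transitivity (tt k (x * inv y, Z1, Z0, Z0)%F5).
  by rewrite -[RHS](ttZ _ _ y0); congr tt; case: (y) y0 => // _; case: (x).
by rewrite /line_vals; move: (x * inv y)%F5; case.
Qed.

(** The six weights sum to 132 - 104 - 25 = 3; each is below 5 and so equals its residue. *)
Lemma sum_line_vals k : pointed k -> sumn (line_vals k) = 3.
Proof.
move=> pk; have ak := pointed_arc pk.
have E g : g \in pencil e2 e1 -> wt k g + plsum k g = 22.
  by move=> hg; apply: (wtE ak); move: g hg; apply/allP; vm_compute.
have s3 : \sum_(g <- pencil e2 e1) wt k g = 3.
  have : \sum_(g <- pencil e2 e1) (wt k g + plsum k g) = 132.
    by rewrite big_seq (eq_bigr (fun=> 22)) // -big_seq big_const_seq.
  have := pencil_plsum ak e2 e1; rewrite (pointed_line pk) big_split /= => ->; lia.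
rewrite /line_vals sumnE big_map -[RHS]s3 big_seq [RHS]big_seq; apply: eq_bigr => g hg.
have := leq_sum_mem (P := predT) (wt k) hg isT; rewrite s3.
by rewrite /tt; case: (wt k g) => [|[|[|[|]]]].
Qed.

Lemma exists_line_pattern k : pointed k ->
  exists2 k', pointed k' & line_vals k' \in patterns.
Proof.
move=> pk; have := @line_act_pattern (line_vals k) erefl (sum_line_vals pk).
case/hasP => [[[[a b] c] d]]; rewrite mem_filter => /andP[det _] hpat.
pose i := inv (a * d - b * c)%F5.
pose N : mat := ((a, b, Z0, Z0), (c, d, Z0, Z0), e3, e4).
pose M : mat := ((i * d, i * - c, Z0, Z0)%F5, (i * - b, i * a, Z0, Z0)%F5, e3, e4).
have MN : dualmat M N.
  by move: det; rewrite /M /N /i; case: (a); case: (b); case: (c); case: (d).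
have N1 : mapply N e1 = (a, b, Z0, Z0) by rewrite /N; case: (a); case: (b).
have N2 : mapply N e2 = (c, d, Z0, Z0) by rewrite /N; case: (c); case: (d).
have ln : lnsum k (mapply N e2) (mapply N e1) = lnsum k e2 e1.
  rewrite N1 N2; apply: eq_bigl => [[[[x y] z] t]].
  have d2 u v : orth (u, v, Z0, Z0) (x, y, z, t) = is0 (u * x + v * y)%F5.
    by congr is0; rewrite /dot; ring.
  rewrite !d2; apply/eqP; apply/implyP: det.
  have : forall u v w s : F5, all (fun x => all (fun y => ~~ is0 (u * s - v * w)%F5 ==>
      (is0 (w * x + s * y)%F5 && is0 (u * x + v * y)%F5
       == is0 (Z0 * x + Z1 * y)%F5 && is0 (Z1 * x + Z0 * y)%F5)) F5s) F5s.
    by move=> u v w s; have := V_forall (P := fun q : V => let: (u, v, w, s) := q in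
      all (fun x => all (fun y => ~~ is0 (u * s - v * w)%F5 ==>
      (is0 (w * x + s * y)%F5 && is0 (u * x + v * y)%F5
       == is0 (Z0 * x + Z1 * y)%F5 && is0 (Z1 * x + Z0 * y)%F5)) F5s) F5s);
      move=> /(_ _ (u, v, w, s)); apply; vm_compute.
  by move=> /(_ a b c d)/F5_forall/(_ x)/F5_forall/(_ y).
have M3 : mapply M e3 = vscale Z1 e3 by rewrite /M /mapply /vscale /vadd; congr (_, _, _, _); ring.
have M4 : mapply M e4 = vscale Z1 e4 by rewrite /M /mapply /vscale /vadd; congr (_, _, _, _); ring.
have pk' := pointed_map MN (isT : Z1 != Z0) (isT : Z1 != Z0) M3 M4 ln pk.
exists (k \o mapply M) => //.
have <- : line_act (a, b, c, d) (line_vals k) = line_vals (k \o mapply M); last by [].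
have ab0 s : (s * a + c, s * b + d)%F5 != (Z0, Z0).
  by move: det; case: (a); case: (b); case: (c); case: (d); case: s.
have a0 : (a, b) != (Z0, Z0) by move: det; case: (a); case: (b); case: (c); case: (d).
have ak := pointed_arc pk.
rewrite /line_act [in RHS]/line_vals /pencil [RHS]map_cons -map_comp.
congr (_ :: _); first by rewrite (tt_map _ MN ak) N1 -line_valE.
apply: eq_map => s; rewrite /comp (tt_map _ MN ak) mapplyD mapplyZ N1 N2.
rewrite -line_valE //; congr tt; rewrite /vadd /vscale.
by congr (_, _, _, _); ring.
Qed.

(** * Lexicographically least slices *)

Fixpoint lexle (s t : seq nat) : bool :=
  match s, t with
  | a :: s', b :: t' => if a < b then true else if a == b then lexle s' t' else false
  | [::], _ => true
  | _, [::] => false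
  end.

Lemma lexle_total s t : lexle s t || lexle t s.
Proof.
elim: s t => [|a s IH] [|b t] //=.
by case: ltngtP => //= ->; rewrite eqxx.
Qed.

Lemma lexle_trans : transitive lexle.
Proof.
move=> t; elim: t => [|b t IH] [|a s] [|c u] //=.
case: (ltngtP a b) => [ab _|//|->]; last by case: (ltngtP b c) => // _; apply: IH.
by case: (ltngtP b c) => [bc|//|<-]; rewrite ?(ltn_trans ab bc) ?ab.
Qed.

Lemma lexle_min (T : eqType) (r : seq T) (f : T -> seq nat) : r != [::] ->
  exists2 x, x \in r & forall y, y \in r -> lexle (f x) (f y).
Proof.
elim: r => // x [_ _|z r /(_ isT)[y hy my] _].
  exists x; rewrite ?mem_head // => y; rewrite inE => /eqP ->.
  by have := lexle_total (f x) (f x); rewrite orbb.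
have [xy|yx] := orP (lexle_total (f x) (f y)).
  exists x; rewrite ?mem_head // => w; rewrite inE => /predU1P[->|/my yw].
    by have := lexle_total (f x) (f x); rewrite orbb.
  exact: lexle_trans xy yw.
exists y; first by rewrite inE hy orbT.
by move=> w; rewrite inE => /predU1P[->|/my].
Qed.

(* The triple (l, a, b) stands for the change of coordinates
   (x, y, z) -> (x + a z, y + b z, l z), which fixes the line z = t = 0,
   or for the same change with t in place of z. *)
Definition trs : seq (F5 * F5 * F5) :=
  flatten [seq flatten [seq [seq (l, a, b) | b <- F5s] | a <- F5s]
    | l <- [:: Z1; Z2; Z3; Z4]].

Lemma mem_trs l a b : ((l, a, b) \in trs) = (l != Z0).
Proof. by case: l; case: a; case: b; vm_compute. Qed.

Definition vals25 (f : F5 -> F5 -> nat) : seq nat :=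
  flatten [seq [seq f x y | x <- F5s] | y <- F5s].

Lemma eq_vals25 f f' : (forall x y, f x y = f' x y) -> vals25 f = vals25 f'.
Proof. by move=> e; congr flatten; apply: eq_map => y; apply: eq_map => x. Qed.

Definition valA (k : V -> nat) (tr : F5 * F5 * F5) : seq nat :=
  let: (l, a, b) := tr in vals25 (fun x y => tt k (x + a, y + b, l, Z0)%F5).

Definition valB (k : V -> nat) (tr : F5 * F5 * F5) : seq nat :=
  let: (l, a, b) := tr in vals25 (fun x y => tt k (x + a, y + b, Z0, l)%F5).

Record normal (k : V -> nat) : Prop := Normal {
  normal_pointed : pointed k;
  normal_line : line_vals k \in patterns;
  normal_A : forall tr, tr \in trs -> lexle (valA k (Z1, Z0, Z0)) (valA k tr);
  normal_B : forall tr, tr \in trs -> lexle (valB k (Z1, Z0, Z0)) (valB k tr) }.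

Lemma eq_line_vals k k' :
  (forall x y, tt k' (x, y, Z0, Z0) = tt k (x, y, Z0, Z0)) -> line_vals k' = line_vals k.
Proof.
move=> e; rewrite /line_vals; apply/eq_in_map => g hg.
have /allP/(_ _ hg) : all (fun g : V => let: (x, y, z, t) := g in is0 z && is0 t) (pencil e2 e1).
  by vm_compute.
by case: g {hg} => [[[x y] z] t] /andP[/is0P -> /is0P ->].
Qed.

Lemma exists_normal k : arc k -> exists k', normal k'.
Proof.
move=> /exists_pointed[k0 /exists_line_pattern[{}k pk hl]].
have ak := pointed_arc pk.
have [[[l a] b] hA mA] := @lexle_min _ trs (valA k) isT.
have l0 : l != Z0 by rewrite mem_trs in hA.
pose NA : mat := (e1, e2, (a, b, l, Z0), e4).
pose MA : mat := ((Z1, Z0, - (inv l * a), Z0), (Z0, Z1, - (inv l * b), Z0),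
                  (Z0, Z0, inv l, Z0), e4)%F5.
have MNA : dualmat MA NA by rewrite /MA /NA; case: (l) l0 => // _; case: (a); case: (b).
have NAE x y z t : mapply NA (x, y, z, t) = (x + z * a, y + z * b, z * l, t)%F5.
  by rewrite /NA /mapply /vadd /vscale; congr (_, _, _, _); ring.
have pA : pointed (k \o mapply MA).
  apply: (pointed_map (c := inv l) (d := Z1) MNA) pk => //; first by case: (l) l0.
  by rewrite /MA /mapply /vadd /vscale; congr (_, _, _, _); ring.
have akA := pointed_arc pA.
set kA := k \o mapply MA in pA akA.
have ttA x y z t : tt kA (x, y, z, t) = tt k (x + z * a, y + z * b, z * l, t)%F5.
  by rewrite /kA (tt_map _ MNA) // NAE.
have minA tr : tr \in trs -> lexle (valA kA (Z1, Z0, Z0)) (valA kA tr).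
  case: tr => [[l' a'] b']; rewrite mem_trs => hl'.
  have -> : valA kA (Z1, Z0, Z0) = valA k (l, a, b).
    by apply: eq_vals25 => x y; rewrite ttA; congr tt; congr (_, _, _, _); ring.
  have -> : valA kA (l', a', b') = valA k (l' * l, a' + l' * a, b' + l' * b)%F5.
    by apply: eq_vals25 => x y; rewrite ttA; congr tt; congr (_, _, _, _); ring.
  by apply: mA; rewrite mem_trs; case: (l) l0 => // _; case: (l') hl'.
have lA : line_vals kA = line_vals k.
  by apply: eq_line_vals => x y; rewrite ttA; congr tt; congr (_, _, _, _); ring.
clearbody kA; clear NA MA MNA NAE ttA hA mA l0 pk ak; move: pA akA minA lA.
rename k into k1, kA into k; move=> pk ak minA lA; rewrite -lA in hl; clear l a b k1 k0 lA.
have [[[l a] b] hB mB] := @lexle_min _ trs (valB k) isT.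
have l0 : l != Z0 by rewrite mem_trs in hB.
pose N : mat := (e1, e2, e3, (a, b, Z0, l)).
pose M : mat := ((Z1, Z0, Z0, - (inv l * a)), (Z0, Z1, Z0, - (inv l * b)), e3,
                  (Z0, Z0, Z0, inv l))%F5.
have MN : dualmat M N by rewrite /M /N; case: (l) l0 => // _; case: (a); case: (b).
have NE x y z t : mapply N (x, y, z, t) = (x + t * a, y + t * b, z, t * l)%F5.
  by rewrite /N /mapply /vadd /vscale; congr (_, _, _, _); ring.
have pB : pointed (k \o mapply M).
  apply: (pointed_map (c := Z1) (d := inv l) MN) pk => //; first by case: (l) l0.
  by rewrite /M /mapply /vadd /vscale; congr (_, _, _, _); ring.
set kB := k \o mapply M in pB.
have ttB x y z t : tt kB (x, y, z, t) = tt k (x + t * a, y + t * b, z, t * l)%F5.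
  by rewrite /kB (tt_map _ MN) // NE.
(* The second change of coordinates fixes every plane with t = 0, so the minimum reached by the
   first one survives. *)
have AE tr : valA kB tr = valA k tr.
  case: tr => [[l' a'] b']; apply: eq_vals25 => x y.
  by rewrite ttB; congr tt; congr (_, _, _, _); ring.
exists kB; split; first exact: pB.
- have -> : line_vals kB = line_vals k; last exact: hl.
  by apply: eq_line_vals => x y; rewrite ttB; congr tt; congr (_, _, _, _); ring.
- by move=> tr; rewrite !AE; apply: minA.
case=> [[l' a'] b']; rewrite mem_trs => hl'.
have -> : valB kB (Z1, Z0, Z0) = valB k (l, a, b).
  by apply: eq_vals25 => x y; rewrite ttB; congr tt; congr (_, _, _, _); ring.
have -> : valB kB (l', a', b') = valB k (l' * l, a' + l' * a, b' + l' * b)%F5.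
  by apply: eq_vals25 => x y; rewrite ttB; congr tt; congr (_, _, _, _); ring.
by apply: mB; rewrite mem_trs; case: (l) l0 => // _; case: (l') hl'.
Qed.

(* As tt k h <= 3, the value Z1, for which no weight is possible, may be sent to
   a number exceeding every sum of interest. *)
Definition tw (r : F5) : nat :=
  match r with Z2 => 0 | Z3 => 1 | Z4 => 2 | Z0 => 3 | Z1 => 31 end.

(** Homogeneity of degree 4, with c^4 = 1. *)
Lemma evqZ (c : F5) q h : c != Z0 -> evq q (vscale c h) = evq q h.
Proof.
case: q => [[[[[[[[[[[[g4 g3] g2] g1] g0] A] B] m2] l1] k1] n1] n2] n3].
case: A => [[[[[[a30 a21] a12] a03] [[a20 a11] a02]] [a10 a01]] a00].
case: B => [[[[[[b30 b21] b12] b03] [[b20 b11] b02]] [b10 b01]] b00].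
case: m2 => [[m20 m11] m02]; case: l1 => [l10 l01]; case: k1 => [k10 k01].
case: h => [[[x y] z] t].
by case: c => // _; rewrite /evq /qline /slice_at /row /horner /vscale; ring.
Qed.

Definition weighted (k : V -> nat) (q : quartic) : Prop :=
  forall h : V, h != v0 -> tt k h = tw (evq q h).

Lemma arc_weighted k : arc k -> exists q, weighted k q.
Proof.
move=> ak; have [q hq] := arc_quartic ak; exists q => h h0.
have [c c0 e] := vnormE h0; have [t1 n1] := hq _ (vnorm_pts h0).
rewrite e in t1 n1; rewrite ttZ // evqZ // in t1 n1.
by rewrite t1; move: n1; case: (evq q h).
Qed.

(** * Enumeration of the slices within the budget *)

Definition rsum (r : form4) : nat :=
  tw (horner r Z0) + (tw (horner r Z1) + (tw (horner r Z2) +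
    (tw (horner r Z3) + tw (horner r Z4)))).

Definition ssum (g : form4) (s : slice) : nat :=
  rsum (row g s Z0) + rsum (row g s Z1) + rsum (row g s Z2) +
    rsum (row g s Z3) + rsum (row g s Z4).

Section Table.
Variable X : Type.

(** A function on [F5] stored as a tuple, so that call-by-value evaluation computes each value
    once. *)
Definition quint : Type := (X * X * X * X * X)%type.

Definition tab (f : F5 -> X) : quint := (f Z0, f Z1, f Z2, f Z3, f Z4).

Definition get (t : quint) (i : F5) : X :=
  let: (a, b, c, d, e) := t in
  match i with Z0 => a | Z1 => b | Z2 => c | Z3 => d | Z4 => e end.

Lemma getE f i : get (tab f) i = f i.
Proof. by case: i. Qed.

End Table.

Definition choose (X : Type) (f : F5 -> seq X) : seq X :=
  f Z0 ++ f Z1 ++ f Z2 ++ f Z3 ++ f Z4.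

Lemma mem_choose (X : eqType) (f : F5 -> seq X) i x : x \in f i -> x \in choose f.
Proof. by rewrite !mem_cat; case: i => ->; rewrite ?orbT. Qed.

Definition guard (X Y : Type) (o : option X) (f : X -> seq Y) : seq Y :=
  if o is Some b then f b else [::].

Lemma guardE (X Y : Type) b (f : X -> seq Y) : guard (Some b) f = f b.
Proof. by []. Qed.

Definition bind (X Y : Type) (l : seq X) (f : X -> seq Y) : seq Y :=
  flatten [seq f x | x <- l].

Lemma mem_bind (X Y : eqType) (l : seq X) (f : X -> seq Y) x y :
  x \in l -> y \in f x -> y \in bind l f.
Proof. by move=> hx hy; apply/flatten_mapP; exists x. Qed.

Fixpoint spend (b r : nat) : option nat :=
  match r, b with
  | 0, _ => Some b
  | r'.+1, b'.+1 => spend b' r'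
  | _, _ => None
  end.

Lemma spendE b r : r <= b -> spend b r = Some (b - r).
Proof. by elim: r b => [|r IH] [|b] //= /IH. Qed.

Definition row_table : Type := quint (quint (quint (quint (option nat)))).

Definition rowtab (r4 : F5) : row_table :=
  tab (fun r3 => tab (fun r2 => tab (fun r1 => tab (fun r0 =>
    let n := rsum (r4, r3, r2, r1, r0) in if n <= 30 then Some n else None)))).

Definition srow (rt : row_table) (b : nat) (r : form4) : option nat :=
  let: (_, r3, r2, r1, r0) := r in
  if get (get (get (get rt r3) r2) r1) r0 is Some n then spend b n else None.

Lemma srowE r4 r3 r2 r1 r0 b : b <= 30 -> rsum (r4, r3, r2, r1, r0) <= b ->
  srow (rowtab r4) b (r4, r3, r2, r1, r0) = Some (b - rsum (r4, r3, r2, r1, r0)).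
Proof. by move=> b30 rb; rewrite /srow /rowtab !getE (leq_trans rb b30) spendE. Qed.

Definition slice_tree : Type :=
  quint (quint (quint (quint (seq (form2 * form1 * F5 * nat))))).

(* The affine parts with a given cubic part, together with what they leave of
   the budget 30.  The rows y = 0, 1, 2 are parametrised by the values p1, p0,
   p0' of their new coefficients, so that each row is filtered only once. *)
Definition slices (g : form4) : slice_tree :=
  let: (q40, q31, q22, q13, q04) := g in
  let rt := rowtab q40 in
  tab (fun c30 =>
    let l0 := choose (fun c20 => choose (fun c10 => choose (fun c00 =>
      guard (srow rt 30 (q40, c30, c20, c10, c00)) (fun b => [:: (c20, c10, c00, b)])))) in
  tab (fun c21 =>
    let l1 := bind l0 (fun e => let: (c20, c10, c00, b) := e in
      choose (fun p1 => choose (fun p0 =>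
      guard (srow rt b (q40, c30 + q31, c20 + (c21 + q22), p1, p0)%F5)
        (fun b => [:: (c20, c10, c00, p1, p0, b)])))) in
  tab (fun c12 =>
    let l2 := bind l1 (fun e => let: (c20, c10, c00, p1, p0, b) := e in
      let c11 := (p1 - (c10 + (c12 + q13)))%F5 in
      let r1 := (c10 + Z2 * (c11 + Z2 * (c12 + Z2 * q13)))%F5 in
      choose (fun p0' =>
      guard (srow rt b (q40, c30 + Z2 * q31, c20 + Z2 * (c21 + Z2 * q22), r1, p0')%F5)
        (fun b => [:: (c20, c10, c00, c11, p0, p0', b)]))) in
  tab (fun c03 =>
    bind l2 (fun e => let: (c20, c10, c00, c11, p0, p0', b) := e in
      let a := (p0 - (c00 + (c03 + q04)))%F5 in
      let d := (p0' - (c00 + (Z3 * c03 + q04)))%F5 in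
      let c02 := (Z3 * (d - Z2 * a))%F5 in
      let c01 := (a - c02)%F5 in
      let s := (c30, c21, c12, c03, (c20, c11, c02), (c10, c01), c00) in
      guard (srow rt b (row g s Z3)) (fun b =>
      guard (srow rt b (row g s Z4)) (fun b =>
        [:: (c20, c11, c02, (c10, c01), c00, b)]))))))).

Definition bucket (t : slice_tree) (c : form3) : seq (form2 * form1 * F5 * nat) :=
  let: (c30, c21, c12, c03) := c in get (get (get (get t c30) c21) c12) c03.

Lemma mem_slices g (s : slice) : ssum g s <= 30 ->
  (s.1.1.2, s.1.2, s.2, 30 - ssum g s) \in bucket (slices g) s.1.1.1.
Proof.
case: g => [[[[q40 q31] q22] q13] q04].
case: s => [[[[[[c30 c21] c12] c03] [[c20 c11] c02]] [c10 c01]] c00].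
set g := (q40, q31, q22, q13, q04); set s := (c30, c21, c12, c03, _, _, c00).
rewrite /ssum.
have E0 : row g s Z0 = (q40, c30, c20, c10, c00).
  by rewrite /row /=; congr (_, _, _, _, _); ring.
have E1 : row g s Z1 = (q40, c30 + q31, c20 + (c21 + q22), c10 + (c11 + (c12 + q13)),
   c00 + (c01 + (c02 + (c03 + q04))))%F5.
  by rewrite /row /=; congr (_, _, _, _, _); ring.
have E2 : row g s Z2 = (q40, c30 + Z2 * q31, c20 + Z2 * (c21 + Z2 * q22),
   c10 + Z2 * (c11 + Z2 * (c12 + Z2 * q13)),
   c00 + Z2 * (c01 + Z2 * (c02 + Z2 * (c03 + Z2 * q04))))%F5 by [].
rewrite E0 E1 E2.
set p1 := (c10 + (c11 + (c12 + q13)))%F5.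
set p0 := (c00 + (c01 + (c02 + (c03 + q04))))%F5.
set p0' := (c00 + Z2 * (c01 + Z2 * (c02 + Z2 * (c03 + Z2 * q04))))%F5.
set r0 := rsum _; set r1 := rsum _; set r2 := rsum _.
set r3 := rsum _; set r4 := rsum _ => le.
rewrite /s; cbv beta iota zeta delta [bucket slices g fst snd]; rewrite -/s -/g !getE.
have F1 : (p1 - (c10 + (c12 + q13)))%F5 = c11 by rewrite /p1; ring.
(* Rows y = 1 and y = 2 give a = c01 + c02 and d = 2 c01 + 4 c02; the factor 3 is the inverse of
   2. *)
pose a := (p0 - (c00 + (c03 + q04)))%F5.
pose d := (p0' - (c00 + (Z3 * c03 + q04)))%F5.
have F2 : (Z3 * (d - Z2 * a))%F5 = c02 by rewrite /d /a /p0 /p0'; ring.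
have F3 : (a - c02)%F5 = c01 by rewrite /a /p0; ring.
apply: (@mem_bind _ _ _ _ (c20, c10, c00, c11, p0, p0', 30 - r0 - r1 - r2)).
  apply: (@mem_bind _ _ _ _ (c20, c10, c00, p1, p0, 30 - r0 - r1)).
    apply: (@mem_bind _ _ _ _ (c20, c10, c00, 30 - r0)).
      apply: (mem_choose (i := c20)); apply: (mem_choose (i := c10)).
      apply: (mem_choose (i := c00)); rewrite srowE //; first exact: mem_head.
      by rewrite -/r0; lia.
    apply: (mem_choose (i := p1)); apply: (mem_choose (i := p0)).
    by rewrite srowE -/r1 ?mem_head; lia.
  rewrite F1; apply: (mem_choose (i := p0')).
  by rewrite srowE -/r2 ?mem_head; lia.
rewrite -/a -/d F2 F3 -/s -/g.
have G y : row g s y = (q40, (row g s y).1.1.1.2, (row g s y).1.1.2,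
  (row g s y).1.2, (row g s y).2) by [].
rewrite G srowE -?G -/r3; [|lia..]; rewrite guardE.
rewrite G srowE -?G -/r4; [|lia..]; rewrite guardE inE.
by apply/eqP; congr (_, _, _, _); lia.
Qed.

(* Unlike [all], stops at the first failure under call-by-value evaluation. *)
Fixpoint every (X : Type) (p : X -> bool) (l : seq X) : bool :=
  if l is x :: l' then if p x then every p l' else false else true.

Lemma everyP (X : eqType) (p : X -> bool) (l : seq X) x : every p l -> x \in l -> p x.
Proof.
elim: l => //= y l IH; case: ifP => // py /IH hl; rewrite inE.
by case/predU1P => [->|/hl].
Qed.

Definition entries (t : slice_tree) : seq (slice * nat) :=
  choose (fun c30 => choose (fun c21 => choose (fun c12 => choose (fun c03 =>
    [seq (let: (m2, m1, m0, b) := e in (c30, c21, c12, c03, m2, m1, m0, b))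
    | e <- bucket t (c30, c21, c12, c03)])))).

Lemma mem_entries g (s : slice) : ssum g s <= 30 ->
  (s, 30 - ssum g s) \in entries (slices g).
Proof.
move=> /mem_slices; case: s => [[[[[[c30 c21] c12] c03] m2] m1] m0] hs.
apply: (mem_choose (i := c30)); apply: (mem_choose (i := c21)).
apply: (mem_choose (i := c12)); apply: (mem_choose (i := c03)).
exact: (map_f (fun e : form2 * form1 * F5 * nat =>
  let: (m2, m1, m0, b) := e in (c30, c21, c12, c03, m2, m1, m0, b)) hs).
Qed.

Definition svals (g : form4) (s : slice) : quint (quint nat) :=
  tab (fun y => let r := row g s y in tab (fun x => tw (horner r x))).

(** By homogeneity the third coordinate l can be scaled to 1, so each change of coordinates only
    permutes the table v. *)
Definition tvals (v : quint (quint nat)) (tr : F5 * F5 * F5) : seq nat :=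
  let: (l, a, b) := tr in let i := inv l in
  vals25 (fun x y => get (get v (i * (y + b))) (i * (x + a)))%F5.

Definition lexmin (g : form4) (s : slice) : bool :=
  let v := svals g s in let v1 := tvals v (Z1, Z0, Z0) in
  every (fun tr => lexle v1 (tvals v tr)) trs.

Lemma lexminP g s (f : F5 * F5 * F5 -> seq nat) :
  (forall tr, tr \in trs -> f tr = tvals (svals g s) tr) ->
  (forall tr, tr \in trs -> lexle (f (Z1, Z0, Z0)) (f tr)) -> lexmin g s.
Proof.
move=> fE fmin; rewrite /lexmin -fE ?mem_trs //.
have : {subset trs <= trs} by [].
elim: {1 3}trs => //= tr l IH sub.
rewrite -fE ?fmin ?sub ?mem_head //; apply: IH => x hx; apply: sub.
by rewrite inE hx orbT.
Qed.

Section Weighted.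
Variables (k : V -> nat) (q : quartic).
Hypotheses (ak : arc k) (wk : weighted k q).

Lemma svalsE x y z t : (z, t) != (Z0, Z0) ->
  get (get (svals (qline q) (slice_at q z t)) y) x = tt k (x, y, z, t).
Proof.
move=> zt; rewrite wk; first by rewrite /svals !getE.
by apply: contra zt => /eqP[_ _ -> ->].
Qed.

Lemma valAE tr : tr \in trs ->
  valA k tr = tvals (svals (qline q) (slice_at q Z1 Z0)) tr.
Proof.
case: tr => [[l a] b]; rewrite mem_trs => l0; apply: eq_vals25 => x y.
rewrite svalsE // -[RHS](ttZ k _ l0); congr tt.
have li u : (l * (inv l * u))%F5 = u by case: (l) l0; case: u.
by rewrite /vscale /= !li; case: (l) l0.
Qed.

Lemma valBE tr : tr \in trs ->
  valB k tr = tvals (svals (qline q) (slice_at q Z0 Z1)) tr.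
Proof.
case: tr => [[l a] b]; rewrite mem_trs => l0; apply: eq_vals25 => x y.
rewrite svalsE // -[RHS](ttZ k _ l0); congr tt.
have li u : (l * (inv l * u))%F5 = u by case: (l) l0; case: u.
by rewrite /vscale /= !li; case: (l) l0.
Qed.

Definition directions : seq (F5 * F5) := (Z1, Z0) :: [seq (c, Z1) | c <- F5s].

Lemma directions_perm (z t : F5) : (z, t) \in directions -> perm_eq
  [seq h <- pts | orth (Z0, Z0, - t, z)%F5 h]
  (flatten [seq [seq (x, y, z, t) | x <- F5s] | y <- F5s] ++ pencil e2 e1).
Proof.
pose P z t := perm_eq [seq h <- pts | orth (Z0, Z0, - t, z)%F5 h]
  (flatten [seq [seq (x, y, z, t) | x <- F5s] | y <- F5s] ++ pencil e2 e1).
have /allP h : all (fun zt : F5 * F5 => P zt.1 zt.2) directions by vm_compute.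
by move/h.
Qed.

(** The planes through (0, 0, -t, z) are the six of the pencil and the 25 planes (x, y, z, t) with
    these z and t. *)
Lemma tP_slice (z t : F5) : (z, t) \in directions ->
  tP k (Z0, Z0, - t, z)%F5 =
    ssum (qline q) (slice_at q z t) + sumn (line_vals k).
Proof.
move=> hd; rewrite /tP -big_filter (perm_big _ (directions_perm hd)) big_cat.
rewrite [in RHS]sumnE big_map; congr (_ + _).
have zt : (z, t) != (Z0, Z0) by move: hd; case: (z); case: (t).
have E x y : tw (horner (row (qline q) (slice_at q z t) y) x) = tt k (x, y, z, t).
  by rewrite -svalsE // /svals !getE.
by rewrite /ssum /rsum !E -[LHS](big_map (tt k) xpredT id) -sumnE [LHS]/=; lia.
Qed.

End Weighted.

(* The slice at (c, 1) has a cubic part determined by A and B; its quadratic part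
   determines m2, and two slices determine everything but one coefficient. *)
Definition cubic_at (A B : slice) (c : F5) : form3 :=
  let: (a30, a21, a12, a03) := A.1.1.1 in let: (b30, b21, b12, b03) := B.1.1.1 in
  (c * a30 + b30, c * a21 + b21, c * a12 + b12, c * a03 + b03)%F5.

Definition quad_at (A B : slice) (m2 : form2) (c : F5) : form2 :=
  let: (a20, a11, a02) := A.1.1.2 in let: (b20, b11, b02) := B.1.1.2 in
  let: (m20, m11, m02) := m2 in
  (c * (c * a20 + m20) + b20, c * (c * a11 + m11) + b11, c * (c * a02 + m02) + b02)%F5.

Definition quad_sol (A B : slice) (c : F5) (e : form2) : form2 :=
  let: (a20, a11, a02) := A.1.1.2 in let: (b20, b11, b02) := B.1.1.2 in
  let: (e20, e11, e02) := e in let i := inv c in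
  (i * (e20 - b20) - c * a20, i * (e11 - b11) - c * a11, i * (e02 - b02) - c * a02)%F5.

(* The quartics whose slices at (c, 1) and (c', 1) have the given linear and
   constant parts; the parameter is the coefficient n1. *)
Definition quartic_sol (g : form4) (A B : slice) (m2 : form2) (c c' : F5)
    (e1 e1' : form1) (e0 e0' n1 : F5) : quartic :=
  let: (a10, a01) := A.1.2 in let: (b10, b01) := B.1.2 in
  let a00 := A.2 in let b00 := B.2 in
  let: (e10, e01) := e1 in let: (e10', e01') := e1' in
  let i := inv c in let i' := inv c' in let j := inv (c - c')%F5 in
  let cc := (c * c)%F5 in let cc' := (c' * c')%F5 in
  let u := (i * (e10 - b10) - cc * a10)%F5 in
  let u' := (i' * (e10' - b10) - cc' * a10)%F5 in
  let v := (i * (e01 - b01) - cc * a01)%F5 in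
  let v' := (i' * (e01' - b01) - cc' * a01)%F5 in
  let w := (i * (e0 - b00) - cc * (c * a00 + n1))%F5 in
  let w' := (i' * (e0' - b00) - cc' * (c' * a00 + n1))%F5 in
  let l10 := (j * (u - u'))%F5 in let l01 := (j * (v - v'))%F5 in
  let n2 := (j * (w - w'))%F5 in
  (g, A, B, m2, (l10, l01), (u - c * l10, v - c * l01), n1, n2, w - c * n2)%F5.

Definition pairs (t : slice_tree) (g : form4) (A B : slice) (c c' : F5)
    (p : quartic -> bool) : bool :=
  let l' := bucket t (cubic_at A B c') in
  every (fun e => let: (e2, e1, e0, _) := e in
    let m2 := quad_sol A B c e2 in let q2 := quad_at A B m2 c' in
    every (fun e' => let: (e2', e1', e0', _) := e' in
      if e2' == q2 then
        every (fun n1 => p (quartic_sol g A B m2 c c' e1 e1' e0 e0' n1)) F5s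
      else true) l') (bucket t (cubic_at A B c)).

Lemma pairsP (c c' : F5) q (p : quartic -> bool) : c \in [:: Z1; Z2] -> c' \in [:: Z2; Z3] ->
  c != c' -> ssum (qline q) (slice_at q c Z1) <= 30 ->
  ssum (qline q) (slice_at q c' Z1) <= 30 ->
  pairs (slices (qline q)) (qline q) (slice_at q Z1 Z0) (slice_at q Z0 Z1) c c' p -> p q.
Proof.
move=> hc hc' cc /mem_slices h /mem_slices h'.
case: q h h' => [[[[[[[[g A] B] m2] l1] k1] n1] n2] n3].
case: A => [[[[[[a30 a21] a12] a03] [[a20 a11] a02]] [a10 a01]] a00].
case: B => [[[[[[b30 b21] b12] b03] [[b20 b11] b02]] [b10 b01]] b00].
case: m2 => [[m20 m11] m02]; case: l1 => [l10 l01]; case: k1 => [k10 k01].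
set A := (a30, a21, a12, a03, (a20, a11, a02), (a10, a01), a00).
set B := (b30, b21, b12, b03, (b20, b11, b02), (b10, b01), b00).
set q := (g, A, B, _, _, _, n1, n2, n3).
have -> : slice_at q Z1 Z0 = A.
  by rewrite /slice_at /q /A /B; congr (_, _, _, _, (_, _, _), (_, _), _); ring.
have -> : slice_at q Z0 Z1 = B.
  by rewrite /slice_at /q /A /B; congr (_, _, _, _, (_, _, _), (_, _), _); ring.
have -> : qline q = g by [].
have C d : (slice_at q d Z1).1.1.1 = cubic_at A B d.
  by rewrite /cubic_at /slice_at /q /A /B /=; congr (_, _, _, _); ring.
rewrite !C; set b := 30 - _; set b' := 30 - _; move: b b' => b b' h h'.
rewrite /pairs => /everyP/(_ h); move: h => _.
have Q d : (slice_at q d Z1).1.1.2 = quad_at A B (m20, m11, m02) d.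
  by rewrite /quad_at /slice_at /q /A /B /=; congr (_, _, _); ring.
have c0 : c != Z0 by move: hc; case: (c).
have c0' : c' != Z0 by move: hc'; case: (c').
have QS : quad_sol A B c (slice_at q c Z1).1.1.2 = (m20, m11, m02).
  rewrite Q /quad_at /quad_sol /A /B /=.
  by case: (c) c0 => // _ /=; congr (_, _, _); ring.
rewrite QS => /everyP/(_ h'); rewrite Q eqxx => /everyP/(_ (mem_F5s n1)).
congr (p _); rewrite /quartic_sol /slice_at /q /A /B /=.
move: hc hc' cc; rewrite !inE => /orP[/eqP->|/eqP->] /orP[/eqP->|/eqP->] // _;
  rewrite -?[inv (Z1 - Z2)%F5]/Z4 -?[inv (Z1 - Z3)%F5]/Z2 -?[inv (Z2 - Z3)%F5]/Z4 /=;
  by congr (_, _, _, _, (_, _), (_, _), _, _, _); ring.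
Qed.

(** The second components are the unspent parts of the budget 30. Those of the slice at [e4] are at
    least 10 because [tP k e4] is at most 23, and not below those at [e3] by minimality; 33 - a.2 is
    [tP k e4]. Later pairs skip the forms already met by the first pair. *)
Definition search (dead : nat -> quartic -> bool) (g : form4) : bool :=
  let t := slices g in
  let l := [seq e <- entries t | lexmin g e.1] in
  every (fun a : slice * nat => if a.2 < 10 then true else
    every (fun b : slice * nat => if a.2 < b.2 then true else
      let d := dead (33 - a.2) in
      let small c q := ssum g (slice_at q c Z1) <= 30 in
      if pairs t g a.1 b.1 Z1 Z2 d then
        if pairs t g a.1 b.1 Z1 Z3 (fun q => if small Z2 q then true else d q) then
          pairs t g a.1 b.1 Z2 Z3 (fun q => if small Z1 q then true else d q)
        else false
      else false) l) l.

Definition axis (c : F5) : V := (Z0, Z0, - Z1, c)%F5.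

Lemma axis_sum k : pointed k ->
  k (axis Z1) + k (axis Z2) + k (axis Z3) + k (axis Z4) = 3.
Proof.
move=> pk; have ak := pointed_arc pk; have := pointed_line pk.
have pm : perm_eq [seq q <- pts | orth e2 q && orth e1 q]
    (map vnorm (e4 :: [seq axis c | c <- F5s])) by vm_compute.
rewrite /lnsum -big_filter (perm_big _ pm) big_map.
have -> : \sum_(v <- e4 :: [seq axis c | c <- F5s]) k (vnorm v)
    = \sum_(v <- e4 :: [seq axis c | c <- F5s]) k v.
  rewrite big_seq [RHS]big_seq; apply: eq_bigr => v hv.
  by rewrite (arc_norm ak) //; move: v hv; apply/allP.
rewrite big_cons big_map !big_cons big_nil (pointed_e4 pk).
have -> : k (axis Z0) = 1 by rewrite -(pointed_e3 pk) -(arc_inv ak e3 (isT : Z4 != Z0)).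
by lia.
Qed.

Lemma tP_le33 k (v : V) : arc k -> v != v0 -> k v = 1 -> tP k v <= 33.
Proof.
move=> ak v0' kv; have := tP_uP ak (vnorm_pts v0'); rewrite (arc_norm ak) // kv.
by have [c c0 ->] := vnormE v0'; rewrite tPZ //; lia.
Qed.

Definition small_axis (k : V -> nat) (c : F5) : bool := tP k (axis c) <= 33.

(** The line has exactly one point off the arc, so two of these three points are on it. The
    conclusion is phrased by [tP] because the search sees only residues. *)
Lemma two_small_axes k : pointed k ->
  [|| small_axis k Z1 && small_axis k Z2, small_axis k Z1 && small_axis k Z3
    | small_axis k Z2 && small_axis k Z3].
Proof.
move=> pk; have ak := pointed_arc pk; have := axis_sum pk.
have le c : k (axis c) <= 1.
  have n0 : axis c != v0 by [].
  by rewrite -(arc_norm ak n0) arc_le1 // vnorm_pts.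
have h c : k (axis c) = 1 -> small_axis k c by apply: tP_le33.
have := le Z1; have := le Z2; have := le Z3; have := le Z4.
have := h Z1; have := h Z2; have := h Z3.
case: (k (axis Z1)) => [|[|//]]; case: (k (axis Z2)) => [|[|//]];
case: (k (axis Z3)) => [|[|//]];
  by do 3![move/(_ erefl) => -> | move=> _]; rewrite ?orbT //; lia.
Qed.

Lemma search_sound k q dead : normal k -> weighted k q -> search dead (qline q) ->
  dead (tP k e4) q.
Proof.
case=> pk _ minA minB wk; have ak := pointed_arc pk.
have sE (z t : F5) : (z, t) \in directions ->
    tP k (Z0, Z0, - t, z)%F5 = ssum (qline q) (slice_at q z t) + 3.
  by move=> hd; rewrite (tP_slice wk hd) sum_line_vals.
have tA : tP k e4 = ssum (qline q) (slice_at q Z1 Z0) + 3 by exact: (sE Z1 Z0).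
have tB : tP k e3 = ssum (qline q) (slice_at q Z0 Z1) + 3.
  by rewrite -(sE Z0 Z1) // -(tPZ k e3 (isT : Z4 != Z0)).
have tC c : tP k (axis c) = ssum (qline q) (slice_at q c Z1) + 3.
  by apply: (sE c Z1); case: c.
have light := pointed_light pk.
have AB := pointed_min pk (isT : e3 != v0) (pointed_e3 pk).
have B33 := tP_le33 ak (isT : e3 != v0) (pointed_e3 pk).
have A30 : ssum (qline q) (slice_at q Z1 Z0) <= 30 by lia.
have B30 : ssum (qline q) (slice_at q Z0 Z1) <= 30 by lia.
have LA : lexmin (qline q) (slice_at q Z1 Z0).
  by apply: (lexminP _ minA) => tr; apply: valAE.
have LB : lexmin (qline q) (slice_at q Z0 Z1).
  by apply: (lexminP _ minB) => tr; apply: valBE.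
rewrite /search; set l := filter _ _ => hs.
have memA : (slice_at q Z1 Z0, 30 - ssum (qline q) (slice_at q Z1 Z0)) \in l.
  by rewrite mem_filter mem_entries // andbT; exact: LA.
have memB : (slice_at q Z0 Z1, 30 - ssum (qline q) (slice_at q Z0 Z1)) \in l.
  by rewrite mem_filter mem_entries // andbT; exact: LB.
move: hs => /everyP/(_ memA); cbv beta zeta delta [fst snd]; cbv iota.
have -> : 30 - ssum (qline q) (slice_at q Z1 Z0) < 10 = false by lia.
move=> /everyP/(_ memB); cbv beta zeta delta [fst snd]; cbv iota.
have -> : 30 - ssum (qline q) (slice_at q Z1 Z0)
    < 30 - ssum (qline q) (slice_at q Z0 Z1) = false by lia.
have -> : 33 - (30 - ssum (qline q) (slice_at q Z1 Z0)) = tP k e4 by lia.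
case: ifP => // h12; case: ifP => // h13 h23.
have := two_small_axes pk; rewrite /small_axis !tC.
have e30 n : (n + 3 <= 33) = (n <= 30) by rewrite -[33]/(30 + 3) leq_add2r.
rewrite !e30.
have [s1|s1] := boolP (_ <= 30); have [s2|s2] := boolP (_ <= 30) => /=.
- by move=> _; apply: pairsP h12.
- rewrite orbF => s3; have := pairsP _ _ _ s1 s3 h13; rewrite (negbTE s2); exact.
- rewrite ?orbF => s3; have := pairsP _ _ _ s2 s3 h23; rewrite (negbTE s1); exact.
- by [].
Qed.

(** * Exclusion by counting *)

Fixpoint msum (m : seq bool) (s : seq nat) : nat :=
  match m, s with
  | b :: m', x :: s' => if b then x + msum m' s' else msum m' s'
  | _, _ => 0
  end.

Lemma msumE (T : Type) (P : pred T) (F : T -> nat) (l : seq T) :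
  msum [seq P x | x <- l] [seq F x | x <- l] = \sum_(x <- l | P x) F x.
Proof. by elim: l => [|x l IH] /=; rewrite ?big_nil // big_cons IH. Qed.

Fixpoint fsum (f : nat -> nat) (s : seq nat) : nat :=
  if s is x :: s' then f x + fsum f s' else 0.

Lemma fsumE (T : Type) f (F : T -> nat) (l : seq T) :
  fsum f [seq F x | x <- l] = \sum_(x <- l) f (F x).
Proof. by elim: l => [|x l IH] /=; rewrite ?big_nil // big_cons IH. Qed.

Fixpoint fsum2 (f : nat -> nat -> nat) (s t : seq nat) : nat :=
  match s, t with
  | x :: s', y :: t' => f x y + fsum2 f s' t'
  | _, _ => 0
  end.

Lemma fsum2E (T : Type) f (F G : T -> nat) (l : seq T) :
  fsum2 f [seq F x | x <- l] [seq G x | x <- l] = \sum_(x <- l) f (F x) (G x).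
Proof. by elim: l => [|x l IH] /=; rewrite ?big_nil // big_cons IH. Qed.

Definition incidence : seq (seq bool) := [seq [seq orth p h | h <- pts] | p <- pts].

Lemma incidenceE (F : V -> nat) :
  [seq msum r [seq F h | h <- pts] | r <- incidence]
  = [seq \sum_(h <- pts | orth p h) F h | p <- pts].
Proof. by rewrite /incidence -map_comp; apply: eq_map => p; apply: msumE. Qed.

(* Points p with tP k p > 33 or tP k p < m, hence in the complement of the arc. *)
Definition outer (m x : nat) : bool := if 33 < x then true else x < m.

(* A lower bound for uu k h when c points of h are known to be outer. *)
Definition ulow (t c : nat) : nat := (c - (5 + t)) %/ 5.

Definition feasible (lo x : nat) (his : seq nat) : bool :=
  has (fun a => [&& (x - 10 * a) %% 25 == 0, 10 * a <= x & all (leq a) his])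
    (iota lo (x %/ 10).+1).

(* With X = 1144 - sum t^2, S = sum t and U = sum u, the value A = sum t u satisfies
   10 A + 25 sum u^2 = X and
   5 A + 110 U + 31 S = X + 33 * 104 + (sum of tP outside the arc).
   The last sum is bounded through the 52 points outside the arc by comparing
   tP with a threshold th.  The final test weighs the planes with 5 t + 2 d <= 17,
   d being the number of points with tP = 18 on the plane. *)
Definition kill (m : nat) (t : seq nat) : bool :=
  let p := [seq msum r t | r <- incidence] in
  if fsum (fun x => 58 < x) p != 0 then true else
  if 52 < fsum (outer m) p then true else
  let c := [seq msum r [seq (outer m x : nat) | x <- p] | r <- incidence] in
  let s := fsum id t in
  let u := (208 - s) %/ 5 in
  let x := 1144 - fsum (fun a => a * a) t in
  let lo := u + fsum2 (fun a b => a.-1 * ulow a b) t c in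
  let hi th := (x + 33 * 104 + 52 * th + fsum (fun y => y - th) p
    - (110 * u + 31 * s + fsum (fun y => if outer m y then th - y else 0) p)) %/ 5 in
  let his := [:: hi 18; hi 23; hi 28; hi 33] in
  if ~~ feasible lo x his then true else
  let d := [seq msum r [seq (y == 18 : nat) | y <- p] | r <- incidence] in
  if fsum2 (fun a b => if a == 0 then 0 else 5 * a + 2 * b - 17) t d == 0 then
    ~~ feasible lo x ((17 * u - 6 * fsum (fun y => y == 18) p) %/ 5 :: his)
  else false.

Lemma feasibleP lo x a b his : lo <= a -> x = 10 * a + 25 * b ->
  all (leq a) his -> feasible lo x his.
Proof.
move=> la e ha; apply/hasP; exists a; first by rewrite mem_iota; lia.
by rewrite ha andbT; apply/andP; split; lia.
Qed.

Section Counting.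
Variables (k : V -> nat) (ak : arc k).

Definition sumT := \sum_(h <- pts) tt k h.
Definition sumU := \sum_(h <- pts) uu k h.
Definition sumTT := \sum_(h <- pts) tt k h * tt k h.
Definition sumTU := \sum_(h <- pts) tt k h * uu k h.
Definition sumUU := \sum_(h <- pts) uu k h * uu k h.
Definition sumPout := \sum_(p <- pts) (1 - k p) * tP k p.

Lemma sumT_sumU : sumT + 5 * sumU = 208.
Proof.
rewrite -(sum_wt ak) /sumU big_distrr -big_split /=.
by apply: eq_bigr => h _; rewrite -wt_tu.
Qed.

Lemma sum_squares : sumTT + 10 * sumTU + 25 * sumUU = 1144.
Proof.
rewrite -(sum_wt2 ak) /sumTU /sumUU !big_distrr -!big_split /=.
by apply: eq_bigr => h _; rewrite wt_tu; lia.
Qed.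

Lemma sum_out : \sum_(p <- pts) (1 - k p) = 52.
Proof.
have : \sum_(p <- pts) (1 - k p) + \sum_(p <- pts) k p = 156.
  rewrite -big_split -[RHS]size_pts -sum1_size big_seq [RHS]big_seq.
  by apply: eq_bigr => p hp; have := arc_le1 ak hp; rewrite /=; lia.
by rewrite (arc_tot ak); lia.
Qed.

(** The sum of [uP] over the arc is evaluated through planes, where plsum = 22 - t - 5 u, and
    through points, where tP + 5 uP = 33; [sum_squares] then eliminates the sum of u^2. *)
Lemma counting : 5 * sumTU + 110 * sumU + 31 * sumT + sumTT = 1144 + 33 * 104 + sumPout.
Proof.
have e1 : sumTU + 5 * sumUU + \sum_(p <- pts) k p * uP k p = 22 * sumU.
  rewrite -sum_uu_plsum /sumTU /sumUU /sumU !big_distrr -!big_split /= big_seq [RHS]big_seq.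
  apply: eq_bigr => h /pts_neq0 /(wtE ak); rewrite wt_tu.
  by move: (tt k h) (uu k h) (plsum k h) => a b c e; nia.
have e2 : \sum_(p <- pts) k p * tP k p + 5 * \sum_(p <- pts) k p * uP k p = 33 * 104.
  rewrite -(arc_tot ak) !big_distrr -big_split /= big_seq [RHS]big_seq.
  apply: eq_bigr => p hp; have := tP_uP ak hp; have := arc_le1 ak hp.
  by case: (k p) => [|[|]] //=; lia.
have e3 : \sum_(p <- pts) k p * tP k p + sumPout = 31 * sumT.
  transitivity (\sum_(p <- pts) tP k p).
    rewrite -big_split /= big_seq [RHS]big_seq.
    by apply: eq_bigr => p hp; have := arc_le1 ak hp; case: (k p) => [|[|]] //=; lia.
  transitivity (\sum_(h <- pts) tt k h * \sum_(p <- pts | orth h p) 1).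
    by rewrite sum_point; apply: eq_bigr => p _; rewrite mul1n.
  rewrite /sumT big_distrr big_seq [RHS]big_seq; apply: eq_bigr => h hh.
  by rewrite count_orth ?pts_neq0 // mulnC.
have := sum_squares; lia.
Qed.

Variables (m : nat) (hm : forall p : V, p \in pts -> k p = 1 -> m <= tP k p).

Lemma outer_out (p : V) : p \in pts -> outer m (tP k p) <= 1 - k p.
Proof.
move=> hp; have := arc_le1 ak hp; have := tP_uP ak hp; have := hm hp; rewrite /outer.
case: (k p) => [|[|//]]; first by case: (if _ then _ else _).
by move=> /(_ erefl) ? ? _; case: ltnP; lia.
Qed.

(** With truncated subtraction tP + (th - tP) = th + (tP - th) at each of the 52 points off the arc.
    The second term is kept only at outer points, the last one extended to all points. *)
Lemma sumPout_le th :
  sumPout + \sum_(p <- pts) (if outer m (tP k p) then th - tP k p else 0)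
  <= 52 * th + \sum_(p <- pts) (tP k p - th).
Proof.
rewrite -sum_out big_distrl -!big_split /= big_seq [X in _ <= X]big_seq leq_sum // => p hp.
have := outer_out hp; have : 1 - k p <= 1 by lia.
by case: (1 - k p) => [|[|n]] // _; rewrite /=; case: (outer _ _) => /=; lia.
Qed.

(** Since u > 0 forces t > 0, t u = u + (t - 1) u for t > 0. A plane has 31 points, so c <= 9 + t +
    5 u, and [ulow] rounds the resulting bound on u up. *)
Lemma sumTU_low : sumU + \sum_(h <- pts)
  (tt k h).-1 * ulow (tt k h) (\sum_(p <- pts | orth h p) outer m (tP k p)) <= sumTU.
Proof.
rewrite -big_split /= big_seq [X in _ <= X]big_seq leq_sum // => h hh.
set c := \sum_(p <- pts | orth h p) _.
have le : c <= 9 + tt k h + 5 * uu k h.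
  have : c + plsum k h <= 31.
    rewrite -(count_orth (pts_neq0 hh)) -big_split /= big_seq_cond [X in _ <= X]big_seq_cond.
    apply: leq_sum => p /andP[hp _]; have := outer_out hp; have := arc_le1 ak hp.
    by rewrite /=; lia.
  by have := wtE ak (pts_neq0 hh); rewrite wt_tu; lia.
have lu : ulow (tt k h) c <= uu k h by rewrite /ulow; lia.
have := uu_tt ak hh; case: (tt k h) lu => [|t] lu; last by move=> _ /=; nia.
by case: (uu k h) lu => // u _ /(_ isT).
Qed.

(** Double counting of the class tP = x0 against planes weighted by u: each of its points
    contributes at least 3, and planes with t = 0 have u = 0. *)
Lemma sumTU_class (al be ga x0 : nat) :
  (forall h : V, h \in pts -> tt k h != 0 ->
    al * tt k h + be * \sum_(p <- pts | orth h p) (tP k p == x0) <= ga) ->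
  (forall p : V, p \in pts -> tP k p == x0 -> 3 <= uP k p) ->
  al * sumTU + 3 * be * \sum_(p <- pts) (tP k p == x0) <= ga * sumU.
Proof.
move=> hc hu; rewrite -mulnA (mulnCA 3).
apply: (@leq_trans (al * sumTU + be * \sum_(p <- pts) (tP k p == x0) * uP k p)).
  rewrite leq_add2l leq_mul2l; apply/orP; right.
  rewrite big_distrr /= big_seq [X in _ <= X]big_seq leq_sum // => p hp.
  by have := hu p hp; case: eqP => // _ /(_ isT); rewrite /=; lia.
rewrite -sum_point /sumTU /sumU !big_distrr -big_split /=.
rewrite big_seq [X in _ <= X]big_seq leq_sum // => h hh.
have := hc h hh; have := uu_tt ak hh; case: (uu k h) => [|u]; first by lia.
by move=> /(_ isT); case: (tt k h) => // t _ /(_ isT); nia.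
Qed.

Lemma kill_sound : kill m [seq tt k h | h <- pts] = false.
Proof.
rewrite /kill; cbv zeta; rewrite (incidenceE (tt k)).
rewrite -[[seq \sum_(h <- pts | orth p h) tt k h | p <- pts]]/[seq tP k p | p <- pts].
have E f : [seq f x | x <- [seq tP k p | p <- pts]] = [seq f (tP k p) | p <- pts] :> seq nat.
  by rewrite -map_comp.
rewrite !E !incidenceE !fsum2E !fsumE.
have le58 : \sum_(p <- pts) (58 < tP k p) = 0.
  rewrite big_seq big1 // => p hp; have := tP_uP ak hp.
  by case: (ltnP 58 (tP k p)) => //; lia.
have le52 : \sum_(p <- pts) outer m (tP k p) <= 52.
  by rewrite -sum_out big_seq [X in _ <= X]big_seq leq_sum // => p /outer_out.
rewrite le58 [_ != _]/= ltnNge le52 [~~ true]/=.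
rewrite -/sumT -/sumTT.
have cnt := counting; have TU := sumT_sumU; have sq := sum_squares; have low := sumTU_low.
have -> : (208 - sumT) %/ 5 = sumU by lia.
have hi th : sumTU <= (1144 - sumTT + 33 * 104 + 52 * th + \sum_(p <- pts) (tP k p - th)
    - (110 * sumU + 31 * sumT +
       \sum_(p <- pts) (if outer m (tP k p) then th - tP k p else 0))) %/ 5.
  have := sumPout_le th; move: (\sum_(p <- pts) (if _ then _ else _)) => a.
  move: (\sum_(p <- pts) (tP k p - th)) => b; move: cnt sq; clear; lia.
have eX : 1144 - sumTT = 10 * sumTU + 25 * sumUU by lia.
rewrite (feasibleP low eX) ?[~~ true]/=; last by rewrite /= !hi.
case: ifP => // /eqP h0.
apply/negbF/(feasibleP low eX); rewrite /= !hi !andbT.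
have cl : 5 * sumTU + 3 * 2 * \sum_(p <- pts) (tP k p == 18) <= 17 * sumU.
  apply: sumTU_class => [h hh t0|p hp /eqP e18].
    have := leq_sum_mem (P := predT) (fun h => if tt k h == 0 then 0 else
      5 * tt k h + 2 * \sum_(p <- pts | orth h p) (tP k p == 18) - 17) hh isT.
    by rewrite h0 (negbTE t0) leqn0 subn_eq0.
  by have := tP_uP ak hp; rewrite e18; have := arc_le1 ak hp; lia.
by lia.
Qed.

End Counting.

(** * Exclusion inside a plane *)

(* A line (m, c, hi, sl) of the plane t = 0 records, for the points still to be
   decided, which of them lie on it (m) and how many (c), a bound hi on how many
   of them may be chosen, and a bound sl on how far below hi one may stay.
   Choosing a point of slack s lowers sl to s on all lines through it. *)
Definition sline : Type := (seq bool * nat * nat * nat).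

Definition choose_on (s : nat) (l : sline) : option sline :=
  let: (m, c, hi, sl) := l in
  if m is b :: m' then
    if b then if hi is hi'.+1 then Some (m', c.-1, hi', minn sl s) else None
    else Some (m', c, hi, sl)
  else None.

Definition skip_on (l : sline) : sline :=
  let: (m, c, hi, sl) := l in
  if m is b :: m' then (m', if b then c.-1 else c, hi, sl) else l.

Fixpoint choose_all (s : nat) (ls : seq sline) : option (seq sline) :=
  if ls is l :: ls' then
    if choose_on s l is Some l' then
      if choose_all s ls' is Some r then Some (l' :: r) else None
    else None
  else Some [::].

(** Branches on the first undecided point. A branch dies when a line would exceed its bound, or when
    taking all its undecided points still leaves it more than sl below. *)
Fixpoint refute (ss : seq nat) (ls : seq sline) : bool :=
  if every (fun l : sline => let: (_, c, hi, sl) := l in hi <= c + sl) ls then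
    if ss is s :: ss' then
      if (if choose_all s ls is Some ls' then refute ss' ls' else true) then
        refute ss' [seq skip_on l | l <- ls]
      else false
    else false
  else true.

(** The slack of a chosen point is the sum of the shortfalls of its six lines, hence bounds each of
    them. *)
Fixpoint tight (m : seq bool) (x ss : seq nat) (d : nat) : Prop :=
  match m, x, ss with
  | b :: m', y :: x', s :: ss' => (b -> y = 1 -> d <= s) /\ tight m' x' ss' d
  | _, _, _ => True
  end.

Definition sat (x ss : seq nat) (l : sline) : Prop :=
  let: (m, c, hi, sl) := l in
  [/\ c = count id m, size m = size ss
    & exists2 d, hi = msum m x + d & d <= sl /\ tight m x ss d].

Lemma every_all (X : Type) (p : X -> bool) l : every p l = all p l.
Proof. by elim: l => //= x l ->; case: (p x). Qed.

Lemma msum_le_count m x : all (leq^~ 1) x -> msum m x <= count id m.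
Proof.
elim: m x => [|b m IH] [|y x] //= /andP[y1 /IH le]; case: b => //=; lia.
Qed.

Lemma refute_sound ss ls x : refute ss ls -> size x = size ss -> all (leq^~ 1) x ->
  (forall l, l \in ls -> sat x ss l) -> False.
Proof.
elim: ss ls x => [|s ss IH] ls x; rewrite /refute -/refute.
  case: ifP => // /negP no _ _ x1 hs; apply: no; rewrite every_all.
  apply/allP => -[[[m c] hi] sl] /hs[-> _ [d -> [dl _]]].
  by rewrite leq_add ?msum_le_count.
case: ifP => [_|/negP no _ _ x1 hs]; last first.
  apply: no; rewrite every_all.
  apply/allP => -[[[m c] hi] sl] /hs[-> _ [d -> [dl _]]].
  by rewrite leq_add ?msum_le_count.
case: ifP => // hin hout; case: x => // y x [sx] /= /andP[y1 x1] hs.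
have [y0|ypos] := posnP y.
  apply: (IH _ x hout sx x1) => l /mapP[l' hl' ->]; move: (hs _ hl').
  case: l' {hl'} => [[[[|b m] c] hi] sl] [-> //= [sm] [d -> [dl [_ td]]]].
  split=> //; first by case: b.
  by exists d => //; rewrite y0 add0n; case: b.
have {ypos} {}y1 : y = 1 by lia.
have : exists2 ls', choose_all s ls = Some ls' & forall l, l \in ls' -> sat x ss l.
  elim: ls {hin hout} hs => [_|l ls IHl hs]; first by exists [::].
  have [|r hr sr] := IHl; first by move=> l' hl; apply: hs; rewrite inE hl orbT.
  have : exists2 l', choose_on s l = Some l' & sat x ss l'.
    have := hs l (mem_head l ls).
    case: l {hs} => [[[[|b m] c] hi] sl] [-> //= [sm] [d -> [dl [td tl]]]].
    case: b td => /= td.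
      rewrite y1 add1n addSn; eexists; first by [].
      split=> //; exists d => //; split=> //.
      by rewrite leq_min dl td.
    by eexists; first by []; split=> //; exists d.
  by case=> l' /= -> hl'; rewrite hr; exists (l' :: r) => // l0; rewrite inE => /predU1P[->|/sr].
by case=> ls' e hs'; move: hin; rewrite e => h; apply: (IH ls' x).
Qed.

Definition incidence3 : seq (seq bool) := [seq [seq orth p g | g <- pts3] | p <- pts3].

(** From 132 = sum of t + 5 u + plsum over the pencil and 104 + 5 [lnsum] = sum of plsum; the
    constant is 28 = 132 - 104, and u is contributed by the plane [e4] alone. *)
Definition line_cap (t : V -> nat) (u : nat) (g : V) : nat :=
  (28 - sumn [seq t f | f <- pencil g e4]) %/ 5 - u.

(* Refutes an arc whose planes h have residues t h, and whose plane t = 0 has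
   quotient u.  In that plane, the bounds of the six lines through a point p of
   the arc exceed their actual values by the slack of p in total. *)
Definition local (t : V -> nat) (u : nat) : bool :=
  let m := 22 - t e4 - 5 * u in
  let caps := [seq line_cap t u g | g <- pts3] in
  let sums := zip pts3 [seq msum r caps | r <- incidence3] in
  let cands := [seq e <- sums | e.2 == m + 5] ++ [seq e <- sums | m + 5 < e.2] in
  refute [seq e.2 - (m + 5) | e <- cands]
    (([seq true | e <- cands], size cands, m, 0) ::
     [seq (let mask := [seq orth e.1 p.1 | p <- cands] in (mask, count id mask, e.2, e.2))
     | e <- zip pts3 caps]).

Lemma localE t u :
  let m := 22 - t e4 - 5 * u in
  let sum p := \sum_(g <- pts3 | orth p g) line_cap t u g in
  let c := [seq p <- pts3 | sum p == m + 5] ++ [seq p <- pts3 | m + 5 < sum p] in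
  local t u = refute [seq sum p - (m + 5) | p <- c]
    (([seq true | p <- c], size c, m, 0) ::
    [seq ([seq orth g p | p <- c], count (orth g) c, line_cap t u g, line_cap t u g)
    | g <- pts3]).
Proof.
move=> m sum c; rewrite /local -/m; cbv zeta.
have zipE (f : V -> nat) : zip pts3 [seq f p | p <- pts3] = [seq (p, f p) | p <- pts3].
  by rewrite -{1}[pts3]map_id zip_map.
have -> : [seq msum r [seq line_cap t u g | g <- pts3] | r <- incidence3]
    = [seq sum p | p <- pts3].
  by rewrite /incidence3 -map_comp; apply: eq_map => p; apply: msumE.
rewrite !zipE.
have -> : [seq e <- [seq (p, sum p) | p <- pts3] | e.2 == m + 5] ++
    [seq e <- [seq (p, sum p) | p <- pts3] | m + 5 < e.2] = [seq (p, sum p) | p <- c].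
  by rewrite !filter_map map_cat.
rewrite -!map_comp size_map; congr (refute _ (_ :: _)).
apply: eq_map => g; rewrite /comp -!map_comp.
by rewrite count_map.
Qed.

Lemma local_sound k t : arc k -> (forall h : V, h != v0 -> tt k h = t h) ->
  local t (uu k e4) -> False.
Proof.
move=> ak tE; set u := uu k e4; rewrite localE; cbv zeta; set m := 22 - _ - _.
have pm : \sum_(p <- pts3) k p = m.
  rewrite /pts3 big_filter -/(plsum k e4) /m -tE //.
  have h4 : e4 != v0 by [].
  by have := wtE ak h4; rewrite wt_tu -/u; lia.
have lnE g : \sum_(p <- pts3 | orth g p) k p = lnsum k g e4.
  by rewrite /pts3 big_filter_cond; apply: eq_bigl => p; rewrite andbC.
have ind : all (fun g => all (fun f => f != v0) (pencil g e4)) pts3 by vm_compute.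
have le (g : V) : g \in pts3 -> lnsum k g e4 <= line_cap t u g.
  move=> hg; have := pencil_plsum ak g e4; have /allP n0 := allP ind g hg.
  have : \sum_(f <- pencil g e4) (tt k f + 5 * uu k f + plsum k f) = 132.
    transitivity (\sum_(f <- pencil g e4) 22); last by rewrite big_const_seq.
    by rewrite big_seq [RHS]big_seq; apply: eq_bigr => f /n0 f0; rewrite -wt_tu wtE.
  have e5 : \sum_(f <- pencil g e4) 5 * uu k f = 5 * \sum_(f <- pencil g e4) uu k f.
    by rewrite big_distrr.
  rewrite 2!big_split e5.
  have -> : \sum_(f <- pencil g e4) tt k f = sumn [seq t f | f <- pencil g e4].
    by rewrite sumnE big_map big_seq [RHS]big_seq; apply: eq_bigr => f /n0 /tE.
  have : u <= \sum_(f <- pencil g e4) uu k f by apply: leq_sum_mem; rewrite ?mem_head.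
  rewrite /line_cap; move: (sumn _) (\sum_(f <- _) uu k f) (\sum_(f <- _) plsum k f).
  by move=> a b d /=; lia.
have dbl (p : V) : p \in pts3 ->
    \sum_(g <- pts3 | orth p g) lnsum k g e4 = m + 5 * k p.
  by move=> hp; rewrite -pm -plane_double //; apply: eq_bigr => g _; rewrite lnE.
set sum := fun p : V => \sum_(g <- pts3 | orth p g) line_cap t u g.
have sumE p : sum p = \sum_(g <- pts3 | orth p g) line_cap t u g by [].
have slack (p : V) : p \in pts3 -> k p = 1 -> sum p =
    m + 5 + \sum_(g <- pts3 | orth p g) (line_cap t u g - lnsum k g e4).
  move=> hp k1; have := dbl p hp; rewrite k1 => <-; rewrite sumE -big_split /=.
  rewrite big_seq_cond [RHS]big_seq_cond; apply: eq_bigr => g /andP[/le hg _].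
  by rewrite subnKC.
have k01 (p : V) : p \in pts3 -> k p <= 1.
  by rewrite mem_filter => /andP[_ /(arc_le1 ak)].
set c := _ ++ _ => hr.
have sub : {subset c <= pts3}.
  by move=> p; rewrite mem_cat !mem_filter => /orP[] /andP[].
have perm_c : perm_eq c [seq p <- pts3 | m + 5 <= sum p].
  rewrite /c; have -> : [seq p <- pts3 | sum p == m + 5]
      = [seq p <- [seq p <- pts3 | m + 5 <= sum p] | sum p == m + 5].
    by rewrite -filter_predI; apply: eq_filter => p /=; lia.
  have -> : [seq p <- pts3 | m + 5 < sum p]
      = [seq p <- [seq p <- pts3 | m + 5 <= sum p] | predC (fun p => sum p == m + 5) p].
    by rewrite -filter_predI; apply: eq_filter => p /=; lia.
  by rewrite perm_filterC.
(* At a point of the arc the actual values of the six lines sum to m + 5, so a point with a smaller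
   sum of bounds has k = 0. *)
have big_c (P : pred V) : \sum_(p <- c | P p) k p = \sum_(p <- pts3 | P p) k p.
  rewrite (perm_big _ perm_c) big_filter_cond big_mkcondl big_seq_cond [RHS]big_seq_cond.
  apply: eq_bigr => p /andP[hp _]; case: leqP => // lt.
  by have := k01 p hp; have := slack p hp; case: (k p) => [|[|]] // /(_ erefl); lia.
apply: (refute_sound hr (x := [seq k p | p <- c])); rewrite ?size_map //.
  by rewrite all_map; apply/allP => p /sub /k01.
have tightE (f : V -> nat) (P : pred V) d :
    (forall p, p \in c -> P p -> k p = 1 -> d <= f p) ->
    tight [seq P p | p <- c] [seq k p | p <- c] [seq f p | p <- c] d.
  elim: (c) => //= p l IH hf; split; first by apply: hf; rewrite mem_head.
  by apply: IH => q hq; apply: hf; rewrite inE hq orbT.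
move=> l; rewrite inE => /predU1P[->|/mapP[g hg ->]].
  split; rewrite ?size_map ?count_map ?count_predT //.
  exists 0; last by split=> //; apply: tightE.
  by rewrite addn0 (msumE predT) big_c.
split; rewrite ?size_map ?count_map //.
exists (line_cap t u g - lnsum k g e4).
  by rewrite msumE big_c lnE subnKC // le.
split; first exact: leq_subr.
apply: tightE => p /sub hp gp k1; rewrite -/(sum p) (slack p hp k1) addKn.
by apply: (leq_sum_mem (fun g => line_cap t u g - lnsum k g e4)) hg _; rewrite orthC.
Qed.

(* Up to projective equivalence, the only residues that kill cannot exclude. *)
Definition q128 : quartic :=
  (Z2, Z4, Z4, Z4, Z4, (Z4, Z2, Z3, Z4, (Z4, Z2, Z4), (Z0, Z4), Z2),
   (Z3, Z0, Z4, Z2, (Z2, Z4, Z1), (Z3, Z3), Z2), (Z0, Z4, Z4), (Z1, Z4), (Z1, Z0),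
   Z4, Z4, Z0).

Definition t128 (h : V) : nat := tw (evq q128 h).

Definition points128 : seq nat := [seq msum r [seq t128 h | h <- pts] | r <- incidence].

Definition classes128 : seq nat :=
  [seq msum r [seq (y == 18 : nat) | y <- points128] | r <- incidence].

Lemma sums128 : [&& fsum id [seq t128 h | h <- pts] == 128,
  fsum (fun a => a * a) [seq t128 h | h <- pts] == 264,
  fsum (fun y => y == 18) points128 == 20
  & fsum2 (fun a b => if a == 0 then 0 else 3 * a + b - 9)
      [seq t128 h | h <- pts] classes128 == 0].
Proof. by vm_compute. Qed.

(** Residue 0 forces u = 0, and a weight below 22 leaves only 2, 3, 4 as values u >= 2. *)
Lemma local128 : every (fun h : V => if t128 h == 0 then true else
    every (fun u => if t128 h + 5 * u < 22 then local (t128 \o mapply (frame4 h).1) u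
                    else true) [:: 2; 3; 4]) pts.
Proof. by vm_cast_no_check (erefl true). Qed.

Section Residues128.
Variables (k : V -> nat) (ak : arc k).
Hypothesis t128E : forall h : V, h != v0 -> tt k h = t128 h.

Lemma uu_le1 (h : V) : h \in pts -> uu k h <= 1.
Proof.
move=> hh; case: leqP => // u2; exfalso.
have h0 := pts_neq0 hh; have [MN M4] := frame4P hh.
set M := _.1 in MN M4; set N := _.2 in MN; have NM : dualmat N M by rewrite dualmatC.
have ak' := arc_map NM ak.
have e40 : e4 != v0 by [].
have uE : uu (k \o mapply N) e4 = uu k h by rewrite /uu (wt_map _ NM) // M4.
have tE (g : V) : g != v0 -> tt (k \o mapply N) g = (t128 \o mapply M) g.
  by move=> g0; rewrite (tt_map _ NM) // t128E // (mapply_neq0 MN).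
apply: (local_sound ak' tE); rewrite uE.
have := everyP local128 hh; rewrite -t128E // -/M.
have -> : tt k h == 0 = false.
  by apply/negbTE; rewrite -lt0n (uu_tt ak hh) // (leq_trans _ u2).
have wlt : tt k h + 5 * uu k h < 22.
  by rewrite -wt_tu; apply: (wt_check ak (P := fun w => w < 22)) hh.
have mem : uu k h \in [:: 2; 3; 4] by rewrite !inE; move: u2 wlt; clear; lia.
by move=> /everyP/(_ mem); rewrite wlt.
Qed.

Lemma sumUU_le : sumUU k <= sumU k.
Proof.
rewrite /sumUU /sumU big_seq [X in _ <= X]big_seq; apply: leq_sum => h /uu_le1.
by case: (uu k h) => [|[|]].
Qed.

(** Here sum u = 16 and 10 A + 25 sum u^2 = 880 for A = sum t u. As u <= 1 this gives A >= 48,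
    whereas the 20 points with tP = 18 give 3 A + 60 <= 144. *)
Lemma residues128 : False.
Proof.
have /and4P[/eqP s1 /eqP s2 /eqP n18 /eqP cl] := sums128.
have tE : [seq t128 h | h <- pts] = [seq tt k h | h <- pts].
  by apply/eq_in_map => h /pts_neq0 /t128E ->.
have pE : points128 = [seq tP k p | p <- pts] by rewrite /points128 tE incidenceE.
have dE : classes128 = [seq \sum_(p <- pts | orth h p) (tP k p == 18) | h <- pts].
  by rewrite /classes128 pE -map_comp -(incidenceE (fun p => (tP k p == 18 : nat))).
rewrite tE ?fsumE in s1 s2; rewrite pE fsumE in n18; rewrite tE dE fsum2E in cl.
have c : 3 * sumTU k + 3 * 1 * \sum_(p <- pts) (tP k p == 18) <= 9 * sumU k.
  apply: (sumTU_class ak (x0 := 18)) => [h hh t0|p hp /eqP e18].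
    have := leq_sum_mem (P := predT) (fun h => if tt k h == 0 then 0 else
      3 * tt k h + \sum_(p <- pts | orth h p) (tP k p == 18) - 9) hh isT.
    by rewrite cl (negbTE t0) leqn0 subn_eq0 mul1n.
  by have := tP_uP ak hp; rewrite e18; have := arc_le1 ak hp; lia.
have := sumT_sumU ak; have := sum_squares ak; rewrite /sumT /sumTT s1 s2.
by move: c sumUU_le; rewrite n18; clear; lia.
Qed.

End Residues128.

(* Pairs (M, N) such that N carries the residues of q128 to those of the
   remaining solutions. *)
Definition frames128 : seq (mat * mat) :=
  [:: (((Z2, Z0, Z1, Z1), (Z0, Z2, Z3, Z0), (Z0, Z3, Z0, Z0), (Z4, Z1, Z0, Z0)),
    ((Z0, Z0, Z0, Z1), (Z0, Z0, Z2, Z3), (Z2, Z2, Z2, Z4), (Z4, Z0, Z0, Z2)));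
   (((Z0, Z0, Z1, Z1), (Z1, Z2, Z1, Z0), (Z0, Z3, Z3, Z0), (Z3, Z1, Z1, Z0)),
    ((Z0, Z0, Z0, Z1), (Z0, Z1, Z4, Z1), (Z1, Z2, Z0, Z0), (Z2, Z3, Z2, Z3)));
   (((Z4, Z1, Z2, Z1), (Z4, Z4, Z3, Z0), (Z4, Z4, Z4, Z0), (Z3, Z2, Z2, Z0)),
    ((Z0, Z0, Z0, Z1), (Z0, Z1, Z4, Z1), (Z2, Z1, Z1, Z4), (Z1, Z4, Z0, Z2)));
   (((Z4, Z1, Z1, Z1), (Z4, Z4, Z3, Z0), (Z2, Z1, Z0, Z0), (Z4, Z1, Z0, Z0)),
    ((Z0, Z0, Z0, Z1), (Z0, Z0, Z2, Z3), (Z2, Z2, Z3, Z2), (Z3, Z4, Z4, Z0)));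
   (((Z0, Z4, Z4, Z1), (Z2, Z4, Z3, Z0), (Z3, Z0, Z0, Z0), (Z0, Z3, Z4, Z0)),
    ((Z0, Z0, Z0, Z1), (Z0, Z2, Z1, Z3), (Z2, Z2, Z1, Z3), (Z0, Z1, Z2, Z3)));
   (((Z2, Z4, Z1, Z1), (Z0, Z1, Z3, Z0), (Z0, Z3, Z0, Z0), (Z4, Z3, Z0, Z0)),
    ((Z0, Z0, Z0, Z1), (Z0, Z0, Z2, Z3), (Z1, Z2, Z1, Z4), (Z4, Z0, Z0, Z2)));
   (((Z2, Z1, Z0, Z1), (Z4, Z3, Z2, Z0), (Z0, Z2, Z0, Z0), (Z2, Z3, Z3, Z0)),
    ((Z0, Z0, Z0, Z1), (Z1, Z0, Z1, Z3), (Z2, Z3, Z4, Z3), (Z1, Z0, Z3, Z3)));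
   (((Z3, Z2, Z4, Z1), (Z0, Z2, Z1, Z0), (Z0, Z3, Z0, Z0), (Z3, Z0, Z0, Z0)),
    ((Z0, Z0, Z0, Z1), (Z0, Z0, Z1, Z1), (Z0, Z2, Z1, Z2), (Z2, Z0, Z0, Z4)));
   (((Z4, Z0, Z2, Z1), (Z2, Z3, Z1, Z0), (Z0, Z3, Z0, Z0), (Z1, Z4, Z0, Z0)),
    ((Z0, Z0, Z0, Z1), (Z0, Z0, Z1, Z3), (Z2, Z2, Z0, Z2), (Z1, Z0, Z3, Z0)));
   (((Z3, Z3, Z1, Z1), (Z3, Z4, Z4, Z0), (Z3, Z3, Z4, Z0), (Z4, Z1, Z3, Z0)),
    ((Z0, Z0, Z0, Z1), (Z0, Z1, Z3, Z4), (Z1, Z4, Z4, Z1), (Z2, Z0, Z1, Z3)));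
   (((Z0, Z3, Z4, Z1), (Z2, Z2, Z3, Z0), (Z4, Z1, Z0, Z0), (Z2, Z4, Z0, Z0)),
    ((Z0, Z0, Z0, Z1), (Z0, Z0, Z2, Z2), (Z1, Z2, Z3, Z2), (Z1, Z1, Z2, Z4)))].

Definition dead (m : nat) (q : quartic) : bool :=
  if every (fun h : V => tw (evq q h) <= 3) pts then
    if kill m [seq tw (evq q h) | h <- pts] then true else
    has (fun MN => dualmat MN.1 MN.2 &&
      every (fun h : V => tw (evq q (mapply MN.2 h)) == t128 h) pts) frames128
  else true.

Definition line_forms : seq form4 :=
  [:: (Z2, Z4, Z4, Z4, Z4); (Z2, Z0, Z3, Z0, Z3); (Z2, Z0, Z0, Z0, Z0)].

Lemma search_dead : every (search dead) line_forms.
Proof. by vm_cast_no_check (erefl true). Qed.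

Lemma qline_forms k q : weighted k q -> line_vals k \in patterns ->
  qline q \in line_forms.
Proof.
move=> wk; pose z : slice := (Z0, Z0, Z0, Z0, (Z0, Z0, Z0), (Z0, Z0), Z0).
pose vals (g : form4) := [seq (let: (x, y, _, _) := h in tw (horner (row g z y) x))
  | h <- pencil e2 e1].
have -> : line_vals k = vals (qline q).
  apply/eq_in_map => h hh; have h0 : h != v0 by move: h hh; apply/allP; vm_compute.
  have := wk h h0.
  have /allP/(_ _ hh) : all (fun h : V => let: (x, y, z, t) := h in is0 z && is0 t)
    (pencil e2 e1) by vm_compute.
  case: h {hh h0} => [[[x y] u] v] /andP[/is0P -> /is0P ->] ->; rewrite /evq.
  have -> // : slice_at q Z0 Z0 = z.
  case: q {wk} => [[[[[[[[g A] B] m2] l1] k1] n1] n2] n3].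
  case: A => [[[[[[a30 a21] a12] a03] [[a20 a11] a02]] [a10 a01]] a00].
  case: B => [[[[[[b30 b21] b12] b03] [[b20 b11] b02]] [b10 b01]] b00].
  case: m2 => [[m20 m11] m02]; case: l1 => [l10 l01]; case: k1 => [k10 k01].
  by rewrite /slice_at /z; congr (_, _, _, _, (_, _, _), (_, _), _); ring.
have chk : all (fun a => all (fun b => all (fun c => all (fun d => all (fun e =>
    (vals (a, b, c, d, e) \in patterns) ==> ((a, b, c, d, e) \in line_forms))
    F5s) F5s) F5s) F5s) F5s by vm_compute.
case: (qline q) => [[[[a b] c] d] e].
move: chk => /F5_forall/(_ a)/F5_forall/(_ b)/F5_forall/(_ c).
by move=> /F5_forall/(_ d)/F5_forall/(_ e)/implyP.
Qed.

Lemma every_intro (X : eqType) (p : X -> bool) l : (forall x, x \in l -> p x) -> every p l.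
Proof. by move=> h; rewrite every_all; apply/allP. Qed.

Lemma no_arc k : ~ arc k.
Proof.
move=> /exists_normal[{}k nk]; have pk := normal_pointed nk; have ak := pointed_arc pk.
have [q wq] := arc_weighted ak.
have := everyP search_dead (qline_forms wq (normal_line nk)).
move=> /(search_sound nk wq).
have E : [seq tw (evq q h) | h <- pts] = [seq tt k h | h <- pts].
  by apply/eq_in_map => h /pts_neq0 /wq ->.
rewrite /dead E kill_sound //; last first.
  by move=> p /pts_neq0 p0 kp; apply: (pointed_min pk).
have -> : every (fun h : V => tw (evq q h) <= 3) pts.
  by apply: every_intro => h hh; rewrite -wq ?pts_neq0 // tt_le3.
case/hasP => -[M N] _ /andP[MN /everyP hN].
apply: (residues128 (arc_map MN ak)) => h h0.
rewrite (tt_map _ MN) //.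
have [c c0 e] := vnormE h0.
have := hN _ (vnorm_pts h0); rewrite /t128 e mapplyZ !evqZ // => /eqP <-.
by apply: wq; rewrite (dual_neq0 MN).
Qed.

Import GRing.Theory.

(** * The projective space of the statement *)

Definition toF (a : F5) : 'F_5 := ((f5nat a)%:R)%R.

Definition ofF (x : 'F_5) : F5 := nth Z0 F5s x.

Lemma ofFK : cancel ofF toF.
Proof. by case=> [[|[|[|[|[|m]]]]] hm] //; apply: val_inj. Qed.

Lemma toFK : cancel toF ofF.
Proof. by case. Qed.

Lemma toFD a b : toF (a + b)%F5 = (toF a + toF b)%R.
Proof. by case: a; case: b; apply: val_inj. Qed.

Lemma toFM a b : toF (a * b)%F5 = (toF a * toF b)%R.
Proof. by case: a; case: b; apply: val_inj. Qed.

Definition rv (v : V) : 'rV['F_5]_4 :=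
  let: (a, b, c, d) := v in \row_j toF (nth Z0 [:: a; b; c; d] j).

Definition vr (u : 'rV['F_5]_4) : V :=
  (ofF (u ord0 (inord 0)), ofF (u ord0 (inord 1)), ofF (u ord0 (inord 2)), ofF (u ord0 (inord 3))).

Lemma vrK : cancel vr rv.
Proof.
move=> u; apply/rowP => j; rewrite mxE.
have {2}-> : j = inord j by rewrite inord_val.
by case: j => [[|[|[|[|]]]] hj] //=; rewrite ofFK.
Qed.

Lemma rvK : cancel rv vr.
Proof. by case=> [[[a b] c] d]; rewrite /vr !mxE !inordK //= !toFK. Qed.

Lemma rvZ c v : rv (vscale c v) = (toF c *: rv v)%R.
Proof.
case: v => [[[x y] z] t]; apply/rowP => j; rewrite !mxE.
by case: j => [[|[|[|[|]]]] hj] //=; rewrite toFM.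
Qed.

Lemma rv_dot u v : (rv u *m (rv v)^T)%R = (toF (dot u v))%:M%R.
Proof.
apply/matrixP => i j; rewrite !mxE !ord1 mulr1n.
case: u => [[[a b] c] d]; case: v => [[[x y] z] t].
rewrite !big_ord_recl big_ord0 !mxE /= addr0 !toFD !toFM.
by rewrite -!addrA.
Qed.

Lemma toF_eq0 a : (toF a == 0%R) = is0 a.
Proof. by case: a. Qed.

Lemma rv_eq0 v : (rv v == 0%R) = (v == v0).
Proof.
have <- : rv v0 = 0%R by apply/rowP => j; rewrite !mxE; case: j => [[|[|[|[|]]]]].
by apply/eqP/eqP => [/(can_inj rvK)|->].
Qed.

Lemma vlineZ (F : fieldType) (vT : vectType F) (c : F) (u : vT) :
  c != 0%R -> (<[c *: u]> = <[u]>)%VS.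
Proof.
move=> c0; apply/eqP; rewrite eqEdim -memvE memvZ ?memv_line //=.
by rewrite !dim_vline scaler_eq0 negb_or c0.
Qed.

Lemma rv_point v : v != v0 -> is_point (<[rv v]>%VS : pg_space 'F_5 3).
Proof. by move=> v0'; rewrite /is_point dim_vline rv_eq0 v0'. Qed.

(** The default point is reached only at v = [v0]. *)
Definition pt (v : V) : pg_point 'F_5 3 :=
  insubd (Sub _ (rv_point (isT : e1 != v0)) : pg_point 'F_5 3) <[rv v]>%VS.

Lemma val_pt v : v != v0 -> val (pt v) = <[rv v]>%VS.
Proof. by move=> /rv_point hv; rewrite val_insubd hv. Qed.

Lemma toF_neq0 c : c != Z0 -> toF c != 0%R.
Proof. by case: c. Qed.

Lemma ptZ c v : c != Z0 -> pt (vscale c v) = pt v.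
Proof. by move=> c0; rewrite /pt rvZ vlineZ ?toF_neq0. Qed.

Lemma pt_inj : {in pts &, injective pt}.
Proof.
move=> p q hp hq /(congr1 val); rewrite !val_pt ?pts_neq0 // => e.
have : rv p \in <[rv q]>%VS by rewrite -e memv_line.
case/vlineP => c; rewrite -[c]ofFK -rvZ => /(can_inj rvK) epq.
have c0 : ofF c != Z0.
  apply: contra_neq (pts_neq0 hp) => c0.
  by rewrite epq c0; case: (q) => [[[? ?] ?] ?].
by rewrite -(pts_norm hp) -(pts_norm hq) epq vnormZ.
Qed.

Lemma pt_surj P : exists2 p, p \in pts & pt p = P.
Proof.
have dP : \dim (val P) = 1%N by apply/eqP/(valP P).
have u0 : vpick (val P) != 0%R by rewrite vpick0 -dimv_eq0 dP.
have v0' : vr (vpick (val P)) != v0 by rewrite -rv_eq0 vrK.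
exists (vnorm (vr (vpick (val P)))); first exact: vnorm_pts.
have [c c0 ->] := vnormE v0'; rewrite ptZ //; apply: val_inj; rewrite val_pt // vrK.
by apply/eqP; rewrite eqEdim -memvE memv_pick dim_vline u0 dP.
Qed.

Lemma perm_pt : perm_eq [seq pt p | p <- pts] (index_enum _).
Proof.
apply: uniq_perm; first by rewrite map_inj_in_uniq ?uniq_pts //; exact: pt_inj.
  exact: index_enum_uniq.
move=> P; rewrite mem_index_enum; have [p hp <-] := pt_surj P.
exact: map_f.
Qed.

Lemma mult_pt (K : pg_multiset 'F_5 3) (S : {set pg_point 'F_5 3}) :
  mult K S = \sum_(p <- pts | pt p \in S) K (pt p).
Proof. by rewrite /mult -(perm_big _ perm_pt) big_map. Qed.

Definition hyper (h : V) : pg_space 'F_5 3 :=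
  lker (linfun (mulmxr (rv h)^T : 'rV['F_5]_4 -> 'M_1)).

Lemma mem_hyper h p : (rv p \in hyper h) = orth h p.
Proof.
rewrite memv_ker lfunE /= rv_dot orthC /orth -toF_eq0.
apply/eqP/eqP => [/matrixP/(_ ord0 ord0)|->]; last by apply/matrixP => i j; rewrite !mxE mul0rn.
by rewrite !mxE mulr1n.
Qed.

Lemma hyper_hyperplane h : h != v0 -> is_hyperplane (hyper h).
Proof.
move=> h0; set f := linfun (mulmxr (rv h)^T : 'rV['F_5]_4 -> 'M_1).
have := limg_ker_dim f fullv; rewrite capfv -/(hyper h) dimvf /dim /=.
have le1 : \dim (limg f) <= 1 by rewrite (leq_trans (dimvS (subvf _))) // dimvf.
have : \dim (limg f) != 0%N.
  apply: contra_neq h0 => d0; apply: dot_inj => p; rewrite dotC [RHS]dotC dot0.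
  apply/is0P; rewrite -[is0 _]/(orth h p) -mem_hyper memv_ker -/f -memv0.
  by rewrite (_ : 0%VS = limg f) ?memv_img ?memvf //; apply/eqP; rewrite eq_sym -dimv_eq0 d0.
rewrite /is_hyperplane; move: (\dim (hyper h)) (\dim (limg f)) le1 => a b; lia.
Qed.

Lemma arc_pt (K : pg_multiset 'F_5 3) : is_arc 104 22 K -> arc (K \o pt).
Proof.
case=> tot pl _; split.
- by move=> c v c0; rewrite /= ptZ.
- by rewrite -tot mult_pt; apply: eq_bigl => p; rewrite inE.
move=> h h0; apply: leq_trans (pl _ (hyper_hyperplane h0)).
rewrite mult_pt /plsum leq_eqVlt; apply/orP; left; apply/eqP.
rewrite big_seq_cond [RHS]big_seq_cond; apply: eq_bigl => p.
have [hp|//] := boolP (p \in pts); rewrite inE val_pt ?pts_neq0 //.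
by rewrite -memvE mem_hyper.
Qed.

Theorem theorem6p3 : ~ exists K : pg_multiset 'F_5 3, is_arc 104 22 K.
Proof. by case=> K /arc_pt /no_arc. Qed.
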